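(* Let $d\in\{5,6\}$, let $k\in\mathbb{N}_0$ with $k\ge 7-d$, and let $\Omega\subset\mathbb{R}^2$ be a bilinearly parameterized multi-patch domain as described in the context. Let $\Omega^{(\ell)}$ be a patch of $\Omega$ with $r_\Gamma$ boundary edges, and let $r_V$ be the number of common vertices of these boundary edges. Let $V^{(k)}_{\Omega^{(\ell)}}$ be the patch subspace of $\Omega^{(\ell)}$. Then $$\dim V^{(k)}_{\Omega^{(\ell)}}=\begin{cases}((d-2)(k+1)-3)^2, & r_\Gamma=0,\\ ((d-2)(k+1)-3)\,((d-2)(k+1)), & r_\Gamma=1,\\ ((d-2)(k+1))^2-9, & r_\Gamma=2,\ r_V=0,\\ ((d-2)(k+1))^2, & r_\Gamma=2,\ r_V=1,\\ ((d-2)(k+1)+3)\,((d-2)(k+1)), & r_\Gamma=3.\end{cases}$$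
   Context: **Domain.** $\Omega\subset\mathbb{R}^2$ is the union of $P\ge 2$ closed strictly convex quadrilateral patches $\Omega^{(1)},\dots,\Omega^{(P)}$ with pairwise disjoint interiors. Any two distinct patches have empty intersection, or share exactly one common vertex, or share a whole common edge. For every vertex $x$ of the mesh, $\Omega\setminus\{x\}$ is connected. Each patch is $\Omega^{(\ell)}=\boldsymbol{G}^{(\ell)}([0,1]^2)$ for a bijective, regular, bilinear map $\boldsymbol{G}^{(\ell)}:[0,1]^2\to\Omega^{(\ell)}$. The edges shared by two patches are called non-boundary edges, $\Gamma^{(1)},\dots,\Gamma^{(E)}$; the other patch edges are boundary edges. The valency of a mesh vertex is the number of mesh edges (boundary and non-boundary) ending at it. $\boldsymbol{v}^{(1)},\dots,\boldsymbol{v}^{(V)}$ denote the (inner and boundary) mesh vertices of valency at least $3$; boundary vertices of valency $2$, i.e. those contained in only one patch, are not counted among the $\boldsymbol{v}^{(r)}$. If a vertex has valency $\nu$, then the patches containing it can be listed in counterclockwise order with consecutive ones sharing a non-boundary edge; there are $\nu$ of them (cyclically ordered) if the vertex is inner, and $\nu-1$ of them if it is a boundary vertex. **Spline space.** $\mathcal{S}^d_k$ is the tensor-product spline space of bidegree $(d,d)$ on $[0,1]^2$ with, in both directions, the knot vector in which $0$ and $1$ have multiplicity $d+1$ and each inner knot $\frac{j}{k+1}$, $j=1,\dots,k$, has multiplicity $d-2$. Its tensor-product B-spline basis is $N_{\boldsymbol{i}}$, $\boldsymbol{i}=(i_1,i_2)\in I:=\{0,1,\dots,d+k(d-2)\}^2$.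 **Isogeometric functions.** $V^{(k)}=\{w\in C^2(\Omega): w|_{\Omega^{(\ell)}}\in \mathcal{S}^d_k\circ(\boldsymbol{G}^{(\ell)})^{-1},\ \ell=1,\dots,P\}$. Here $w\in C^2(\Omega)$ means that for any two patches sharing an edge, $w|_{\Omega^{(\ell)}}$ and $w|_{\Omega^{(\ell')}}$ have the same values, gradients and Hessians along the common edge. For such $w$ write $w|_{\Omega^{(\ell)}}=\big(\sum_{\boldsymbol{i}\in I}b^{(\ell)}_{\boldsymbol{i}}N_{\boldsymbol{i}}\big)\circ(\boldsymbol{G}^{(\ell)})^{-1}$; the numbers $b^{(\ell)}_{\boldsymbol{i}}$ are the spline coefficients of $w$. **Index sets.** $\mathcal{I}^{(\ell)}=\{\ell\}\times I$, $\mathcal{I}=\bigcup_\ell\mathcal{I}^{(\ell)}$. - For $\Gamma^{(j)}=\Omega^{(\ell)}\cap\Omega^{(\ell')}$, $\mathcal{I}_{\Gamma^{(j)}}\subset\mathcal{I}$ consists of the indices, in each of the two patches $\Omega^{(\ell)},\Omega^{(\ell')}$, of the column (or row) of coefficients corresponding to $\Gamma^{(j)}$ and of the two columns (rows) next to it, excluding the first three and the last three coefficients of each of these columns (rows). $\mathcal{I}_\Gamma=\bigcup_j\mathcal{I}_{\Gamma^{(j)}}$. - For $\boldsymbol{v}^{(r)}$, $\mathcal{I}_{\Xi^{(r)}}$ consists of all $(\ell,(i_1,i_2))\in\mathcal{I}$ such that $\boldsymbol{v}^{(r)}\in\Omega^{(\ell)}$ and $|i_1-i_1^{(\ell)}|\le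 2$, $|i_2-i_2^{(\ell)}|\le2$, where $(i_1^{(\ell)},i_2^{(\ell)})$ is the corner index of $I$ whose control point in $\Omega^{(\ell)}$ is $\boldsymbol{v}^{(r)}$. $\mathcal{I}_\Xi=\bigcup_r\mathcal{I}_{\Xi^{(r)}}$. **Patch subspace.** $V^{(k)}_{\Omega^{(\ell)}}=\{w\in V^{(k)}: \text{the spline coefficients of } w \text{ vanish on } (\mathcal{I}\setminus\mathcal{I}^{(\ell)})\cup\mathcal{I}_\Gamma\cup\mathcal{I}_\Xi\}$. *)

(* Defs.v *)
From HB Require Import structures.
From mathcomp Require Import all_boot all_order all_algebra finmap.
From mathcomp Require Import all_classical all_reals all_analysis.

Set Implicit Arguments.
Unset Strict Implicit.
Unset Printing Implicit Defensive.

Import Order.TTheory GRing.Theory Num.Theory.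
Import numFieldNormedType.Exports.
Local Open Scope classical_set_scope.
Local Open Scope ring_scope.

Definition pair_coord (T : Type) (dir : bool) (u : T * T) : T :=
  if dir then u.2 else u.1.

Section Plane.
Variable R : realType.
Implicit Types (a b c e u x y z : R * R) (A B : set (R * R)).

Definition e1 : R * R := (1, 0).
Definition e2 : R * R := (0, 1).

Definition det2 a b : R := a.1 * b.2 - a.2 * b.1.

(* b - a and c - b make a strict left turn *)
Definition left_turn a b c : Prop := 0 < det2 (b - a) (c - b).

Definition hull4 a b c e : set (R * R) :=
  [set x | exists s t v w : R,
     [/\ [/\ 0 <= s, 0 <= t, 0 <= v & 0 <= w], s + t + v + w = 1
       & x = s *: a + t *: b + v *: c + w *: e]].

(* The vertices a, b, c, e are listed counterclockwise; all four interior
   angles are smaller than pi. *)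
Definition strictly_convex_quadrilateral A : Prop :=
  exists a b c e, A = hull4 a b c e /\
    [/\ left_turn a b c, left_turn b c e, left_turn c e a & left_turn e a b].

Definition unit_square : set (R * R) :=
  [set u | 0 <= u.1 <= 1 /\ 0 <= u.2 <= 1].

Definition bilinear_map (F : R * R -> R * R) : Prop :=
  exists a b c e, forall u,
    F u = a + u.1 *: b + u.2 *: c + (u.1 * u.2) *: e.

Definition regular_map (F : R * R -> R * R) : Prop :=
  forall u, unit_square u -> det2 ('D_e1 F u) ('D_e2 F u) != 0.

(* f restricted to A and f restricted to B have the same one-sided value at x:
   both are the limits from the interiors. *)
Definition same_trace (f : R * R -> R) A B x : Prop :=
  exists v : R,
    f @ within A° (nbhs x) --> v /\ f @ within B° (nbhs x) --> v.

(* same values, gradients and Hessians *)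
Definition C2_contact (w : R * R -> R) A B x : Prop :=
  [/\ same_trace w A B x,
      forall a, a = e1 \/ a = e2 -> same_trace ('D_a w) A B x
    & forall a b, a = e1 \/ a = e2 -> b = e1 \/ b = e2 ->
        same_trace ('D_a ('D_b w)) A B x].

End Plane.

Section Mesh.
Variables (R : realType) (P : nat) (G : 'I_P -> R * R -> R * R).
Implicit Types (l : 'I_P) (x y : R * R) (Gam : set (R * R)).

Definition patch_set l : set (R * R) := G l @` @unit_square R.

Definition mesh_domain : set (R * R) := [set x | exists l, patch_set l x].

(* Corners of the unit square are coded by p : bool * bool, namely as
   (p.1%:R, p.2%:R); the side s : bool * bool is the one on which the
   coordinate number s.1 (false: first, true: second) equals s.2%:R. *)
Definition vertex l (p : bool * bool) : R * R := G l (p.1%:R, p.2%:R).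

Definition on_side (s p : bool * bool) : bool := pair_coord s.1 p == s.2.

Definition edge l (s : bool * bool) : set (R * R) :=
  G l @` [set u | unit_square u /\ pair_coord s.1 u = s.2%:R].

Definition mesh_vertex x : Prop := exists l p, x = vertex l p.

Definition edges_at x : set (set (R * R)) :=
  [set Gam | exists l s p, [/\ Gam = edge l s, on_side s p & x = vertex l p]].

Definition valency x : nat := #|` fset_set (edges_at x)|%fset.

Definition inner_vertex x : Prop := mesh_vertex x /\ mesh_domain° x.

Definition nonboundary_edge Gam : Prop :=
  exists l l' s s', [/\ l != l', Gam = edge l s & Gam = edge l' s'].

Definition boundary_side l (s : bool * bool) : Prop :=
  ~ nonboundary_edge (edge l s).

(* The patches l and l' share an edge [x, y]; turning counterclockwise around
   x, one passes from l to l' through it. *)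
Definition ccw_next x l l' : Prop :=
  exists s s' p q,
    [/\ edge l s = edge l' s', on_side s p, on_side s q, p != q & x = vertex l p]
    /\ [/\ l != l',
           forall z, patch_set l z -> det2 (vertex l q - x) (z - x) <= 0
         & forall z, patch_set l' z -> 0 <= det2 (vertex l q - x) (z - x)].

Record multipatch_domain : Prop := MultipatchDomain {
  two_patches : (2 <= P)%N;
  patch_convex : forall l, strictly_convex_quadrilateral (patch_set l);
  patch_bilinear : forall l, bilinear_map (G l);
  patch_regular : forall l, regular_map (G l);
  patch_bijective : forall l, set_bij (@unit_square R) (patch_set l) (G l);
  patch_interiors : forall l l', l != l' ->
    (patch_set l)° `&` (patch_set l')° = set0;
  patch_intersection : forall l l', l != l' ->
    [\/ patch_set l `&` patch_set l' = set0,
        exists p p', vertex l p = vertex l' p' /\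
          patch_set l `&` patch_set l' = [set vertex l p]
      | exists s s', edge l s = edge l' s' /\
          patch_set l `&` patch_set l' = edge l s];
  domain_minus_vertex : forall x, mesh_vertex x -> connected (mesh_domain `\ x);
  vertex_fan : forall x, mesh_vertex x ->
    exists fan : seq 'I_P,
      [/\ uniq fan,
          forall l, l \in fan <-> patch_set l x,
          inner_vertex x -> size fan = valency x /\
            cycle (fun l l' => `[< ccw_next x l l' >]) fan
        & ~ inner_vertex x -> (size fan).+1 = valency x /\
            sorted (fun l l' => `[< ccw_next x l l' >]) fan]
}.

Definition nb_boundary_edges l : nat :=
  #|[pred s : bool * bool | `[< boundary_side l s >]]|.

Definition nb_common_vertices l : nat :=
  #|[pred p : bool * bool | `[< exists s s', [/\ s != s',
       boundary_side l s, boundary_side l s', on_side s p & on_side s' p] >]]|.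

End Mesh.

Section Splines.
Variables (R : realType) (d k : nat).

Definition knots : seq R :=
  nseq d.+1 0
  ++ flatten [seq nseq (d - 2) (j%:R / k.+1%:R) | j <- iota 1 k]
  ++ nseq d.+1 1.

(* Cox-de Boor recursion, with _ / 0 = 0; the last nonempty knot interval is
   closed on the right. *)
Fixpoint bspline (t : seq R) (p i : nat) (x : R) : R :=
  if p is q.+1 then
    (x - t`_i) / (t`_(i + p) - t`_i) * bspline t q i x
    + (t`_(i + p).+1 - x) / (t`_(i + p).+1 - t`_i.+1) * bspline t q i.+1 x
  else ((t`_i <= x < t`_i.+1)
        || [&& t`_i < t`_i.+1, x == t`_i.+1 & t`_i.+1 == last 0 t])%:R.

Definition nb_splines : nat := (d + k * (d - 2)).+1.

Definition spline_index := ('I_nb_splines * 'I_nb_splines)%type.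

Definition Nspline (i : spline_index) (u : R * R) : R :=
  bspline knots d i.1 u.1 * bspline knots d i.2 u.2.

(* distance of i to the first (b = false) or last (b = true) index *)
Definition dist_end (b : bool) (i : 'I_nb_splines) : nat :=
  if b then (d + k * (d - 2) - i)%N else i.

End Splines.

Section Isogeometric.
Variables (R : realType) (P : nat) (G : 'I_P -> R * R -> R * R) (d k : nat).
Implicit Types (w : R * R -> R) (l : 'I_P) (i : spline_index d k).

Definition is_coefs w (b : 'I_P -> spline_index d k -> R) : Prop :=
  forall l u, unit_square u -> w (G l u) = \sum_i b l i * Nspline i u.

(* A function on the domain is represented by its extension by zero to the
   plane. *)
Definition isogeometric : set (R * R -> R) :=
  [set w | [/\ forall x, ~ mesh_domain G x -> w x = 0,
     exists b, is_coefs w b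
   & forall l l' s s', l != l' -> edge G l s = edge G l' s' ->
       forall x, edge G l s x -> C2_contact w (patch_set G l) (patch_set G l') x]].

Definition I_patch l : set ('I_P * spline_index d k) := [set li | li.1 = l].

Definition I_edge (Gam : set (R * R)) : set ('I_P * spline_index d k) :=
  [set li | exists s : bool * bool, [/\ edge G li.1 s = Gam,
     (dist_end s.2 (pair_coord s.1 li.2) <= 2)%N,
     (3 <= dist_end false (pair_coord (~~ s.1) li.2))%N
   & (3 <= dist_end true (pair_coord (~~ s.1) li.2))%N]].

Definition I_Gamma : set ('I_P * spline_index d k) :=
  \bigcup_(Gam in nonboundary_edge G) I_edge Gam.

Definition I_vertex (x : R * R) : set ('I_P * spline_index d k) :=
  [set li | exists p : bool * bool, [/\ vertex G li.1 p = x,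
     (dist_end p.1 li.2.1 <= 2)%N & (dist_end p.2 li.2.2 <= 2)%N]].

Definition I_Xi : set ('I_P * spline_index d k) :=
  \bigcup_(x in [set x | mesh_vertex G x /\ (3 <= valency G x)%N]) I_vertex x.

Definition patch_space l : set (R * R -> R) :=
  [set w | isogeometric w /\ exists b, is_coefs w b /\
     forall li, (~` I_patch l `|` I_Gamma `|` I_Xi) li -> b li.1 li.2 = 0].

End Isogeometric.

(* V is a linear subspace of U of dimension n. *)
Definition has_dim (R : realType) (U : lmodType R) (V : set U) (n : nat) : Prop :=
  exists v : 'I_n -> U,
    (forall c : 'I_n -> R, \sum_i c i *: v i = 0 -> forall i, c i = 0) /\
    V = [set x | exists c : 'I_n -> R, x = \sum_i c i *: v i].

(* Main.v *)
Require Import Defs.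
From mathcomp Require Import all_boot all_order all_algebra finmap.
From mathcomp Require Import all_classical all_reals all_analysis.
From mathcomp Require Import ring lra zify.

Set Implicit Arguments.
Unset Strict Implicit.
Unset Printing Implicit Defensive.

Import Order.TTheory GRing.Theory Num.Theory.
Import numFieldNormedType.Exports.
Local Open Scope classical_set_scope.
Local Open Scope ring_scope.

(** The coefficients that the patch subspace of a patch forces to vanish are exactly those in
the three layers next to the sides that the patch shares with a neighbour (vanishing_index).
Conversely, every choice of the other coefficients gives a C^2 function. So the dimension is
the number of indices outside these layers, (n - 3a)(n - 3b) with n = (d - 2)(k + 1) + 3 and
a, b the numbers of shared sides in the two coordinate directions.

Why the free coefficients are free. A spline whose first three layers of coefficients along
a side are zero vanishes there together with its derivatives up to order 2, so its extension
by zero has contact of order 2 with it. Three ingredients enter. (1) B-splines of degree d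
with inner knots of multiplicity d - 2 are C^2, and the one of index i vanishes at the end
point 0 together with its first i - 1 derivatives. This is proved on the polynomial pieces:
their values at a multiple knot are Kronecker deltas up to the degree that equals the
multiplicity, which gives continuity in that degree, and the derivative formula lifts it by
two degrees. (2) The inverse
of the bilinear parametrisation G is smooth enough: G u - G v = M(u,v)(u - v) where the
determinant of M(u,v) is the Jacobian of G at the point (v_1,u_2) of the square, so it is
bounded away from zero. Hence the inverse is Lipschitz and its directional derivatives are
explicit, and derivatives of F o G^-1 have again the form F' o G^-1 (smooth_derive).
(3) A point shared with another patch lies on a side with a neighbour (shared_point), so the
extension by zero is consistent.

Why the forced coefficients are whole layers. Both ends of a shared side have valency at
least 3, which adds the corners to the strips along the edges, whereas a corner between two
boundary sides belongs to one patch only and has valency 2 (boundary_corner). Not all four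
sides can be boundary: the patch would be disjoint from all others, hence, with one corner
removed, open and closed in the domain without this corner (exists_nonboundary_side).

Linear independence of the functions obtained from single coefficients is that of tensor
product B-splines, which follows from local linear independence on each knot interval. *)

(** * Polynomial pieces of B-splines *)

Section Pieces.
Variables (R : realFieldType) (t : nat -> R).

(** The polynomial with which the i-th B-spline of degree p coincides on the j-th knot interval.
Working with polynomials turns derivatives, one-sided values at knots and linear
independence into algebra. *)
Fixpoint piece (j p i : nat) : {poly R} :=
  if p is q.+1 then
    (t (i + p) - t i)^-1 *: (('X - (t i)%:P) * piece j q i)
    + (t (i + p).+1 - t i.+1)^-1 *: (((t (i + p).+1)%:P - 'X) * piece j q i.+1)
  else (i == j)%:R.

Lemma piece_eq0 j p i : ~~ (i <= j <= i + p)%N -> piece j p i = 0.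
Proof.
elim: p i => [|p IH] i /= h.
  by case: eqP h => // ->; rewrite addn0 leqnn.
by rewrite !IH ?mulr0 ?scaler0 ?addr0 //; lia.
Qed.

Lemma horner_piece j p i x : (piece j p.+1 i).[x] =
  (x - t i) / (t (i + p.+1)%N - t i) * (piece j p i).[x]
  + (t (i + p.+1).+1 - x) / (t (i + p.+1).+1 - t i.+1) * (piece j p i.+1).[x].
Proof.
rewrite [piece j p.+1 i]/= hornerD !hornerZ !hornerM hornerXsubC hornerD hornerN hornerX hornerC.
by rewrite !mulrA ![_^-1 * _]mulrC.
Qed.

Lemma horner_piece0 j i x : (piece j 0 i).[x] = (i == j)%:R.
Proof. by rewrite /=; case: eqP => _; rewrite ?hornerC. Qed.

Lemma piece_match j j' p q z : (forall i, (piece j p i).[z] = (piece j' p i).[z]) ->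
  (p <= q)%N -> forall i, (piece j q i).[z] = (piece j' q i).[z].
Proof.
move=> h; elim: q => [|q IH]; first by rewrite leqn0 => /eqP e; subst p.
rewrite leq_eqVlt => /orP[/eqP e|]; first by subst p.
by rewrite ltnS => /IH e i; rewrite !horner_piece !e.
Qed.

Hypothesis t_mono : {homo t : i j / (i <= j)%N >-> i <= j}.

(** At the left end of its interval, where m knots coalesce, one linear factor of the recursion
vanishes and the other is 1, as long as the degree does not exceed m. So the values there are
Kronecker deltas. *)
Lemma piece_at_left j m p i z : (m <= j)%N -> (forall s, (s < m)%N -> t (j - s)%N = z) ->
  z < t j.+1 -> (p <= m)%N -> (piece j p i).[z] = (i + p == j)%N%:R.
Proof.
move=> mj tz zj; elim: p i => [|p IH] i pm; first by rewrite addn0 horner_piece0.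
rewrite horner_piece !IH ?(ltnW pm) // addSn.
rewrite [X in X + _](_ : _ = 0) ?add0r; last first.
  case: eqP => [e|]; last by rewrite mulr0.
  by rewrite -(tz p) // -e addnK subrr !mul0r.
rewrite addnS; case: eqP => [e|_]; last by rewrite !mulr0.
have -> : t i.+1 = z by rewrite -(tz p) //; congr t; lia.
have -> : t (i + p).+2 = t j.+1 by congr t; lia.
by rewrite mulr1 mulfV // subr_eq0 gt_eqF.
Qed.

Lemma piece_at_right j m p i z : (forall s, (0 < s <= m)%N -> t (j + s)%N = z) ->
  t j < z -> (p <= m)%N -> (piece j p i).[z] = (i == j)%:R.
Proof.
move=> tz zj; elim: p i => [|p IH] i pm; first by rewrite horner_piece0.
rewrite horner_piece !IH ?(ltnW pm) //.
rewrite [X in _ + X](_ : _ = 0) ?addr0; last first.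
  case: eqP => [e|]; last by rewrite mulr0.
  by rewrite -(tz p.+1) // -e addSn subrr !mul0r.
case: eqP => [->|_]; last by rewrite !mulr0.
by rewrite tz // mulr1 mulfV // subr_eq0 gt_eqF.
Qed.

(** The values on both sides of an m-fold knot are the same Kronecker delta in degree m, and
they stay equal in higher degrees because the recursion at a point does not depend on the
interval: splines of degree at least the multiplicity are continuous. *)
Lemma piece_match_knot j m q z i : (forall s, (0 < s <= m)%N -> t (j + s)%N = z) ->
  t j < z -> z < t (j + m).+1 -> (m <= q)%N ->
  (piece (j + m)%N q i).[z] = (piece j q i).[z].
Proof.
move=> tz tj zt mq; apply: (piece_match _ mq) => {}i.
rewrite (piece_at_right _ tz) // (@piece_at_left _ m) ?leq_addl ?eqn_add2r //.
by move=> s sm; rewrite -(tz (m - s)%N) ?addnBA // ?subn_gt0 ?sm ?leq_subr // ltnW.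
Qed.

Section Cell.
Variable j : nat.
Hypothesis cell : t j < t j.+1.

(** A zero denominator in the recursion does no harm: the factor that it multiplies is then
the zero polynomial, since a nonzero piece needs a nondegenerate knot interval in its
support. *)
Lemma piece_span p i q i' : (i' <= i)%N -> (i + p < i' + q)%N ->
  (t (i' + q)%N - t i')^-1 * (t (i' + q)%N - t i') *: piece j p i = piece j p i.
Proof.
move=> ii pq; have [h|h] := boolP (i <= j <= i + p)%N; last by rewrite piece_eq0 // scaler0.
rewrite mulVf ?scale1r // subr_eq0 gt_eqF //.
case/andP: h => h1 h2; apply: (le_lt_trans (t_mono (leq_trans ii h1))).
by apply: (lt_le_trans cell); apply: t_mono; lia.
Qed.

Lemma deriv_piece p i : deriv (piece j p.+1 i) =
  p.+1%:R *: ((t (i + p.+1)%N - t i)^-1 *: piece j p i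
              - (t (i + p.+1).+1 - t i.+1)^-1 *: piece j p i.+1).
Proof.
elim: p i => [|p IH] i.
  have d0 (b : bool) : deriv (b%:R : {poly R}) = 0.
    by case: b; [rewrite -[_%:R]polyC1 derivC|rewrite deriv0].
  rewrite /= derivD !derivZ !derivM !d0 !poly.derivE !mulr0 !addr0 mul1r sub0r mulN1r.
  by rewrite scalerN scale1r.
have -> : piece j p.+2 i =
   (t (i + p.+2)%N - t i)^-1 *: (('X - (t i)%:P) * piece j p.+1 i)
    + (t (i + p.+2).+1 - t i.+1)^-1 *: (((t (i + p.+2).+1)%:P - 'X) * piece j p.+1 i.+1) by [].
(* The terms in piece j p i.+1 are the only ones that do not match at once; those coming from
   the two halves of the recursion cancel after the factors of piece_span are removed. *)
rewrite derivD !derivZ !derivM !IH !poly.derivE mul1r sub0r mulN1r.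
rewrite ![piece j p.+1 _]/= -[p.+2%:R]natr1.
have := @piece_span p i.+1 p.+2 i (leqnSn _) ltac:(lia).
have := @piece_span p i.+1 p.+2 i.+1 (leqnn _) ltac:(lia).
rewrite !addnS !addSn -!mul_polyC !polyCM !polyCD !polyCN.
set a := (t (_ + p).+2 - _)^-1; set b := (t (_ + p).+3 - _)^-1.
set c := (t _ - t _)^-1; set e := (t _ - t _)^-1; set f := (t _ - t _)^-1.
set n := p.+1%:R.
set u := piece j p i; set v := piece j p i.+1; set w := piece j p i.+2.
move: u v w n => u v w n; move: a b c e f => a b c e f.
move: (t _) (t _) (t _) (t _) => t3 t1 t2 t0 Ht Ha.
apply/eqP; rewrite -subr_eq0; apply/eqP.
transitivity (n%:P * e%:P * (b%:P * (t0%:P - t2%:P) * v - a%:P * (t1%:P - t3%:P) * v)).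
  by ring.
by rewrite Ht Ha subrr mulr0.
Qed.

Lemma pieceS p i : piece j p.+1 i =
  (t (i + p.+1)%N - t i)^-1 *: (('X - (t i)%:P) * piece j p i)
    + (t (i + p.+1).+1 - t i.+1)^-1 *: (((t (i + p.+1).+1)%:P - 'X) * piece j p i.+1).
Proof. by []. Qed.
Arguments piece : simpl never.

(** Summation by parts has no boundary terms, because the first and the last piece are zero on
the interval. *)
Lemma sum_piece_shift p M (f g : nat -> R) : (p < j < M)%N ->
  \sum_(i < M) (f i *: piece j p i + g i.+1 *: piece j p i.+1)
  = \sum_(i < M) (f i + g i) *: piece j p i.
Proof.
move=> /andP[pj jM]; case: M jM => // M jM.
under [RHS]eq_bigr do rewrite scalerDl.
rewrite !big_split /=; congr (_ + _).
rewrite big_ord_recr [RHS]big_ord_recl /=.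
rewrite [piece j p 0]piece_eq0 ?[piece j p M.+1]piece_eq0; try lia.
by rewrite !scaler0 addr0 add0r.
Qed.

Lemma sum_piece p M : (p <= j < M)%N -> \sum_(i < M) piece j p i = 1.
Proof.
elim: p => [|p IH] pjM.
  rewrite (bigD1 (Ordinal (proj2 (andP pjM)))) //= /piece eqxx big1 ?addr0 // => i.
  by rewrite -val_eqE /= => /negbTE ->.
rewrite -IH; last by lia.
transitivity (\sum_(i < M) (((t (i + p.+1)%N - t i)^-1 *: ('X - (t i)%:P)
   + (t (i + p.+1)%N - t i)^-1 *: ((t (i + p.+1)%N)%:P - 'X)) * piece j p i)).
  under [RHS]eq_bigr do rewrite mulrDl.
  case: M pjM {IH} => [|M] pjM; first by lia.
  rewrite (eq_bigr _ (fun (i : 'I_M.+1) _ => pieceS p i)) !big_split /=; congr (_ + _).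
    by apply: eq_bigr => i _; rewrite scalerAl.
  rewrite big_ord_recr [RHS]big_ord_recl /=.
  rewrite [piece j p 0]piece_eq0 ?[piece j p M.+1]piece_eq0; try lia.
  rewrite !mulr0 scaler0 addr0 add0r; apply: eq_bigr => i _.
  by rewrite -scalerAl /bump /= addSn.
apply: eq_bigr => i _; rewrite -scalerDr [X in _ *: X](_ : _ = (t (i + p.+1)%N - t i)%:P).
  by rewrite -mul_polyC -polyCM mul_polyC; apply: piece_span; rewrite // ltn_add2l.
by rewrite polyCB; ring.
Qed.

(** Local linear independence, by induction on the degree: the derivative of a vanishing
combination makes consecutive coefficients equal, and the partition of unity then says that
their common value is zero. *)
Lemma piece_free p M (c : nat -> R) : (p <= j < M)%N ->
  \sum_(i < M) c i *: piece j p i = 0 -> forall i, (i <= j <= i + p)%N -> c i = 0.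
Proof.
elim: p c => [|p IH] c pjM.
  rewrite (bigD1 (Ordinal (proj2 (andP pjM)))) //= /piece eqxx big1 ?addr0 => [|i].
    rewrite alg_polyC => /eqP; rewrite polyC_eq0 => /eqP cj i.
    by rewrite addn0 -eqn_leq => /eqP ->.
  by rewrite -val_eqE /= => /negbTE ->; rewrite scaler0.
move=> S0.
pose a i := p.+1%:R * (t (i + p.+1)%N - t i)^-1.
have {}IH i : (i <= j <= i + p)%N -> c i = c i.-1.
  move=> ij; have [pj jM] : (p < j)%N /\ (j < M)%N by lia.
  have IHc := IH (fun i => c i * a i + - c i.-1 * a i) ltac:(lia).
  have ai : a i != 0.
    rewrite mulf_neq0 ?pnatr_eq0 // invr_eq0 subr_eq0 gt_eqF //.
    case/andP: ij => ij ji; apply: (le_lt_trans (t_mono ij)); apply: (lt_le_trans cell).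
    by apply: t_mono; rewrite addnS ltnS.
  apply/eqP; rewrite -subr_eq0 -(mulIr_eq0 _ (mulIf ai)) mulrBl; apply/eqP; rewrite -mulNr.
  apply: IHc ij.
  rewrite -(@sum_piece_shift _ _ (fun i => c i * a i) (fun i => - c i.-1 * a i));
    last by rewrite pj.
  rewrite -[RHS](deriv0 R) -[in RHS]S0 raddf_sum; apply: eq_bigr => k _.
  rewrite /= derivZ deriv_piece /a /= scalerBr scalerBr !scalerA mulNr scaleNr addSn.
  by rewrite !mulrA ![c k * _]mulrC.
have ceq i : (i <= j <= i + p.+1)%N -> c i = c j.
  move=> ij; case/andP: (ij) => ij1 ij2; rewrite -(subKn ij1).
  have : (j - i <= p.+1)%N by rewrite leq_subLR.
  elim: (j - i)%N => [|n IHn] np; first by rewrite subn0.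
  by rewrite subnS -(IH (j - n)%N) ?IHn ?(ltnW np) //; lia.
move=> i ij; rewrite ceq //.
move: S0; rewrite (eq_bigr (fun i : 'I_M => c j *: piece j p.+1 i)) => [|k _].
  by rewrite -scaler_sumr sum_piece // alg_polyC => /eqP; rewrite polyC_eq0 => /eqP.
have [h|h] := boolP (k <= j <= k + p.+1)%N; first by rewrite ceq.
by rewrite piece_eq0 // !scaler0.
Qed.
End Cell.
End Pieces.

(** * B-splines on a knot interval, and the knot sequence *)

Section BsplinePiece.
Variables (R : realType) (s : seq R) (t : nat -> R).
Hypothesis t_mono : {homo t : i j / (i <= j)%N >-> i <= j}.
Hypothesis s_t : forall i, (i < size s)%N -> s`_i = t i.

(** The test of the degree 0 case of the Cox-de Boor recursion; in particular the last
nondegenerate interval is closed on the right. *)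
Definition in_cell j x :=
  (t j <= x < t j.+1) || [&& t j < t j.+1, x == t j.+1 & t j.+1 == last 0 s].

Lemma in_cell_inj i j x : (i.+1 < size s)%N -> (j.+1 < size s)%N ->
  in_cell i x -> in_cell j x -> i = j.
Proof.
wlog ij : i j / (i <= j)%N => [hw|] hi hj ci cj.
  by case/orP: (leq_total i j) => h; [|symmetry]; apply: hw.
apply/eqP; rewrite eqn_leq ij /= leqNgt; apply/negP => {}ij.
have tij : t i.+1 <= t j by exact: t_mono.
have lst : t j.+1 <= last 0 s.
  by rewrite -nth_last s_t; [apply: t_mono; rewrite ltn_predRL|rewrite prednK // (leq_trans _ hj)].
case/orP: ci => [/andP[_ xi]|/and3P[_ /eqP xi /eqP li]];
case/orP: cj => [/andP[jx xj]|/and3P[jj /eqP xj _]]; lra.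
Qed.

Lemma bspline_piece j p i x : (j.+1 < size s)%N -> (i + p.+1 < size s)%N -> in_cell j x ->
  bspline s p i x = (piece t j p i).[x].
Proof.
move=> js ips cj; elim: p i ips => [|p IH] i ips.
  rewrite horner_piece0 /= !s_t; try lia.
  rewrite -/(in_cell i x); congr (_%:R); congr nat_of_bool.
  apply/idP/eqP => [ci|->//].
  by apply: (@in_cell_inj i j x) => //; lia.
by rewrite horner_piece -!IH /= ?s_t //; lia.
Qed.
End BsplinePiece.

Section Knots.
Variables (R : realType) (d k : nat).
Hypothesis d3 : (3 <= d)%N.

(** The knot sequence in closed form: after the first d + 1 knots the numerator grows by 1 every
d - 2 steps, which is a rounded-up quotient by d - 2, until it is capped at k + 1. *)
Definition knot (i : nat) : R := (minn k.+1 ((i - d + (d - 3)) %/ (d - 2)))%:R / k.+1%:R.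

Lemma knot_mono : {homo knot : i j / (i <= j)%N >-> i <= j}.
Proof.
move=> i j ij; rewrite /knot ler_wpM2r ?invr_ge0 ?ler0n // ler_nat.
have := @leq_div2r (d - 2) (i - d + (d - 3)) (j - d + (d - 3)) ltac:(lia).
lia.
Qed.

Lemma knot0 i : (i <= d)%N -> knot i = 0.
Proof.
move=> id; rewrite /knot (eqP id) divn_small ?minn0 ?mul0r //; lia.
Qed.

Lemma knotE r s : (0 < s <= d - 2)%N -> knot (d + r * (d - 2) + s)%N =
  (minn k.+1 r.+1)%:R / k.+1%:R.
Proof.
move=> hs; rewrite /knot; congr ((minn _ _)%:R / _).
have -> : (d + r * (d - 2) + s - d + (d - 3) = r.+1 * (d - 2) + s.-1)%N.
  by rewrite mulSn; move: (r * (d - 2))%N => x; lia.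
by rewrite divnMDl ?divn_small ?addn0 //; lia.
Qed.

Lemma size_knots : size (knots R d k) = (d + k * (d - 2) + d.+2)%N.
Proof.
rewrite /knots !size_cat !size_nseq size_flatten /shape -map_comp.
rewrite (eq_map (g := fun=> (d - 2)%N)) => [|j]; last by rewrite /= size_nseq.
rewrite sumnE big_map big_const_seq count_predT size_iota iter_addn_0 mulnC; lia.
Qed.

Lemma nth_flatten_nseq (T : Type) (x0 : T) (f : nat -> T) m a n i : (i < n * m)%N ->
  nth x0 (flatten [seq nseq m (f j) | j <- iota a n]) i = f (a + i %/ m)%N.
Proof.
elim: n a i => [|n IH] a i /= h; first by lia.
have m0 : (0 < m)%N by rewrite lt0n; apply: contraTneq h => ->; rewrite muln0.
rewrite nth_cat size_nseq nth_nseq; case: ifP => im; first by rewrite im divn_small // addn0.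
rewrite IH; last by lia.
have e : i = (1 * m + (i - m))%N by lia.
by rewrite [in RHS]e divnMDl // addSnnS.
Qed.

Lemma nth_knots i : (i < size (knots R d k))%N -> (knots R d k)`_i = knot i.
Proof.
rewrite size_knots => hi.
rewrite /knots !nth_cat !size_nseq !nth_nseq size_flatten /shape -map_comp.
rewrite (eq_map (g := fun=> (d - 2)%N)) => [|j]; last by rewrite /= size_nseq.
rewrite sumnE big_map big_const_seq count_predT size_iota iter_addn_0.
case: ifP => id; first by rewrite id knot0.
have d20 : (0 < d - 2)%N by lia.
case: ifP => ik.
  have [r [s [hs e]]] : exists r s, (0 < s <= d - 2)%N /\ i = (d + r * (d - 2) + s)%N.
    exists ((i - d.+1) %/ (d - 2))%N, ((i - d.+1) %% (d - 2)).+1.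
    have := divn_eq (i - d.+1) (d - 2); have := ltn_pmod (i - d.+1) d20; lia.
  rewrite e knotE // nth_flatten_nseq; last by lia.
  have -> : (d + r * (d - 2) + s - d.+1 = r * (d - 2) + s.-1)%N.
    by move: (r * (d - 2))%N => x; lia.
  rewrite divnMDl // divn_small; last by lia.
  have rk : (r < k)%N by rewrite -(ltn_pmul2r d20); lia.
  congr (_%:R / _); lia.
have -> : (i - d.+1 - (d - 2) * k < d.+1)%N by lia.
rewrite /knot (_ : minn _ _ = k.+1) ?divff ?pnatr_eq0 //.
apply/minn_idPl; rewrite leq_divRL //; lia.
Qed.

End Knots.

(** * Gluing polynomials along breaks *)

Section Glue.
Variable R : realType.

Definition trunc (z : R) (D : {poly R}) (x : R) : R := if z <= x then D.[x] else 0.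

Lemma ler_norm_trunc z D x : `|trunc z D x| <= `|D.[x]|.
Proof. by rewrite /trunc; case: ifP => // _; rewrite normr0. Qed.

Lemma trunc0 z D x : D.[z] = 0 -> x <= z -> trunc z D x = 0.
Proof. by rewrite /trunc => Dz xz; case: ifP => // zx; rewrite (@le_anti _ _ x z) ?xz. Qed.

Lemma trunc_lt z D x : x < z -> trunc z D x = 0.
Proof. by rewrite /trunc leNgt => ->. Qed.

Lemma trunc_ge z D x : z <= x -> trunc z D x = D.[x].
Proof. by rewrite /trunc => ->. Qed.

Lemma trunc_continuous z D : D.[z] = 0 -> continuous (trunc z D).
Proof.
move=> Dz x; rewrite /continuous_at; have [->|xz] := eqVneq x z.
  rewrite trunc0 //; apply/cvgr0Pnorm_le => e e0.
  have /cvgr0Pnorm_le/(_ e e0) : D.[y] @[y --> z] --> 0 by rewrite -Dz; exact: continuous_horner.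
  by apply: filterS => y; apply: le_trans; exact: ler_norm_trunc.
have [zx|zx] := ltP z x; last first.
  have {}zx : x < z by rewrite lt_neqAle xz.
  rewrite trunc_lt //; apply: (@cvg_trans _ (cst 0 @ x)); last exact: (@cst_continuous R R).
  by apply: near_eq_cvg; near=> y; rewrite trunc_lt //; near: y; exact: lt_nbhsl.
rewrite trunc_ge ?ltW //; apply: (@cvg_trans _ (horner D @ x)); last exact: continuous_horner.
by apply: near_eq_cvg; near=> y; rewrite trunc_ge // ltW //; near: y; exact: lt_nbhsr.
Unshelve. all: by end_near.
Qed.

(** A zero of order two makes the cut-off polynomial differentiable at its knot: its
difference quotient there is dominated by that of the polynomial itself. *)
Lemma is_derive_trunc (z : R) (D : {poly R}) (x : R) : D.[z] = 0 -> (deriv D).[z] = 0 ->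
  is_derive x (1 : R) (trunc z D) (trunc z (deriv D) x).
Proof.
move=> Dz D'z; have [->|xz] := eqVneq x z.
  rewrite trunc0 //.
  have q0 : (fun h => h^-1 *: ((trunc z D \o shift z) (h *: 1) - trunc z D z)) @ 0^' --> (0 : R).
    have [/cvg_ex[l /= Dl] El] := is_derive_poly D z.
    have {}El : l = 0 by rewrite -D'z -El; symmetry; exact: cvg_lim.
    apply/cvgr0Pnorm_le => e e0; subst l.
    have /cvgr0Pnorm_le/(_ e e0) := Dl.
    apply: filterS => h; apply: le_trans.
    rewrite Dz [trunc z D z]trunc0 // !subr0 /=
      ![ `|_ *: _| ]normrM ler_wpM2l //; exact: ler_norm_trunc.
  by split; [apply/cvg_ex; exists 0|exact: cvg_lim q0].
have [zx|zx] := ltP z x; last first.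
  have {}zx : x < z by rewrite lt_neqAle xz.
  apply: (@near_eq_is_derive _ _ _ (cst 0)); last first.
    by rewrite trunc_lt //; exact: is_derive_cst.
  by near=> y; rewrite trunc_lt //; near: y; exact: lt_nbhsl.
apply: (@near_eq_is_derive _ _ _ (horner D)); last first.
  by rewrite trunc_ge ?ltW //; exact: is_derive_poly.
by near=> y; rewrite trunc_ge // ltW //; near: y; exact: lt_nbhsr.
Unshelve. all: by end_near.
Qed.

Variables (k : nat) (z : nat -> R).
Hypothesis z_mono : {homo z : i j / (i <= j)%N >-> i <= j}.

(** Piecewise polynomials written as the first piece plus truncated jumps; the regularity at
the r-th break is then a matter of the order of the zero of the r-th jump alone. *)
Definition glue (Q : nat -> {poly R}) (x : R) : R :=
  (Q 0%N).[x] + \sum_(r < k) trunc (z r.+1) (Q r.+1 - Q r) x.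

Lemma glue_cell Q r x : (r <= k)%N -> (0 < r)%N ==> (z r <= x) -> (r < k)%N ==> (x < z r.+1) ->
  glue Q x = (Q r).[x].
Proof.
move=> rk zr zr1; rewrite /glue -(subnKC rk) big_split_ord /= [X in _ + (_ + X)]big1 => [|s _].
  rewrite addr0 (eq_bigr (fun s : 'I_r => (Q s.+1).[x] - (Q s).[x])) => [|s _].
    rewrite -(big_mkord xpredT (fun s => (Q s.+1).[x] - (Q s).[x])).
    by rewrite telescope_sumr // addrC subrK.
  rewrite /trunc hornerD hornerN ifT //.
  move: zr; rewrite (leq_ltn_trans _ (ltn_ord s)) //=; apply: le_trans.
  by apply: z_mono.
have rsk : (r < k)%N by case: s => s /=; rewrite ltn_subRL; apply: leq_ltn_trans; rewrite leq_addr.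
rewrite /trunc ifF // leNgt; apply/negbF.
by move: zr1; rewrite rsk /= => /lt_le_trans; apply; apply: z_mono; rewrite ltnS leq_addr.
Qed.

Lemma glue_continuous Q : (forall r, (r < k)%N -> (Q r.+1 - Q r).[z r.+1] = 0) ->
  continuous (glue Q).
Proof.
move=> h x; apply: cvgD; first exact: continuous_horner.
apply: cvg_big => [|r _]; first exact: add_continuous.
by apply: trunc_continuous; exact: h.
Qed.

Lemma is_derive_glue (Q : nat -> {poly R}) (x : R) :
  (forall r, (r < k)%N -> (Q r.+1 - Q r).[z r.+1] = 0) ->
  (forall r, (r < k)%N -> (deriv (Q r.+1) - deriv (Q r)).[z r.+1] = 0) ->
  is_derive x (1 : R) (glue Q) (glue (fun r => deriv (Q r)) x).
Proof.
move=> h0 h1; apply: is_deriveD.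
rewrite [X in is_derive _ _ X _](_ : _ = \sum_(r < k) trunc (z r.+1) (Q r.+1 - Q r)); last first.
  by apply/funext => y; rewrite fct_sumE.
apply: is_derive_sum => r; rewrite -derivB.
by apply: is_derive_trunc; rewrite ?derivB; [exact: h0|exact: h1].
Qed.

End Glue.

(** For a family whose derivative formula involves only its next lower degree, zeros of the
low degree members force zeros of the higher derivatives. This serves both the pieces and
the jumps between them, which satisfy the same formula. *)
Lemma derivn_recurrence_root (R : realFieldType)
    (F : nat -> nat -> {poly R}) (f g : nat -> nat -> R) :
  (forall p i, deriv (F p.+1 i) = f p i *: F p i + g p i *: F p i.+1) ->
  forall a p i z, (forall s, (i <= s <= i + a)%N -> (F p s).[z] = 0) ->
  ((F (p + a)%N i)^`(a)).[z] = 0.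
Proof.
move=> Fd; elim=> [|a IH] p i z h; first by rewrite addn0 derivn0 h // addn0 leqnn.
rewrite addnS derivSn Fd derivnD !derivnZ hornerD !hornerZ !IH ?mulr0 ?addr0 // => s hs;
  apply: h; lia.
Qed.

(** * B-splines with inner knots of multiplicity d - 2 *)

Lemma poly_eq0_on_itv (R : realFieldType) (p : {poly R}) (a b : R) : a < b ->
  (forall x, a <= x < b -> p.[x] = 0) -> p = 0.
Proof.
move=> ab p0; set n := size p.
pose s := [seq a + (b - a) * (m%:R / n.+1%:R) | m <- iota 0 n].
have inj : injective (fun m : nat => a + (b - a) * (m%:R / n.+1%:R)).
  have ba : b - a != 0 by rewrite subr_eq0 gt_eqF.
  have n0 : (n.+1%:R : R)^-1 != 0 by rewrite invr_eq0 pnatr_eq0.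
  move=> m m' /= e; apply/eqP; rewrite -(eqr_nat R); apply/eqP.
  by apply: (mulIf n0); apply: (mulfI ba); apply: addrI e.
apply: (@roots_geq_poly_eq0 _ p s); last by rewrite size_map size_iota.
  apply/allP => x /mapP[m]; rewrite mem_iota add0n => /andP[_ mn] ->.
  apply/rootP/p0/andP; split.
    by rewrite lerDl mulr_ge0 ?subr_ge0 ?(ltW ab) // divr_ge0.
  rewrite -ltrBrDl gtr_pMr ?subr_gt0 // ltr_pdivrMr ?ltr0n // mul1r ltr_nat.
  by rewrite ltnS ltnW.
by rewrite map_inj_uniq // iota_uniq.
Qed.

Section SplineBasis.
Variables (R : realType) (d k : nat).
Hypothesis d3 : (3 <= d)%N.
Notation t := (knot R d k).

Definition brk (r : nat) : R := r%:R / k.+1%:R.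
Definition cell_start (r : nat) : nat := (d + r * (d - 2))%N.

Lemma brk_lt r s : (brk r < brk s) = (r < s)%N.
Proof. by rewrite ltr_pM2r ?invr_gt0 ?ltr0n // ltr_nat. Qed.

Lemma brk_mono : {homo brk : i j / (i <= j)%N >-> i <= j}.
Proof. by move=> i j ij; rewrite ler_pM2r ?invr_gt0 ?ltr0n // ler_nat. Qed.

Lemma brk_last : brk k.+1 = 1.
Proof. by rewrite /brk divff // pnatr_eq0. Qed.

Lemma knot_after r s : (r <= k)%N -> (0 < s <= d - 2)%N -> t (cell_start r + s)%N = brk r.+1.
Proof. by move=> rk hs; rewrite knotE //; congr (_%:R / _); apply/minn_idPr. Qed.

Lemma knot_cell_start r : (r <= k)%N -> t (cell_start r) = brk r.
Proof.
case: r => [|r] rk; first by rewrite /cell_start mul0n addn0 knot0 // /brk mul0r.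
rewrite -(@knot_after r (d - 2)) ?(ltnW rk) //; last by lia.
by rewrite /cell_start mulSn; congr t; lia.
Qed.

Lemma cell_nonempty r : (r <= k)%N -> t (cell_start r) < t (cell_start r).+1.
Proof.
by move=> rk; rewrite -addn1 knot_after ?knot_cell_start ?brk_lt //; lia.
Qed.

Lemma knot_last i : (cell_start k < i)%N -> t i = 1.
Proof.
move=> ki; apply: le_anti; apply/andP; split.
  by rewrite /knot ler_pdivrMr ?ltr0n // mul1r ler_nat geq_minl.
rewrite -brk_last -(@knot_after k 1) ?addn1 //; last by lia.
exact: knot_mono.
Qed.

Lemma last_knots : last 0 (knots R d k) = 1.
Proof.
have h n (x : R) : last x (nseq n.+1 1) = 1 by elim: n x => // n IH x; exact: (IH 1).
by rewrite /knots !last_cat h.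
Qed.

(** For a at most 2, the a-th derivative of the i-th B-spline, with the outermost polynomial pieces
continued to the whole line so that no one-sided derivatives occur. *)
Definition dspline (a i : nat) (x : R) : R :=
  glue k brk (fun r => (piece t (cell_start r) d i)^`(a)) x.

Lemma bsplineE i x : (i < nb_splines d k)%N -> 0 <= x <= 1 ->
  bspline (knots R d k) d i x = dspline 0 i x.
Proof.
move=> ni /andP[x0 x1].
have P0 : exists r, (r <= k)%N && (brk r <= x) by exists 0%N; rewrite /brk mul0r.
have [r /andP[rk rx] rmax] := ex_maxnP P0 (fun r h => proj1 (andP h)).
rewrite /dspline (glue_cell brk_mono _ rk) ?rx ?implybT //; last first.
  apply/implyP => rk'; rewrite ltNge; apply/negP => xr.
  by have := rmax r.+1; rewrite rk' xr ltnn => /(_ isT).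
have cell : (cell_start r <= cell_start k)%N by rewrite leq_add2l leq_mul2r rk orbT.
apply: (bspline_piece (t := t)).
- exact: knot_mono.
- by move=> j jn; rewrite nth_knots.
- by rewrite size_knots //; move: cell; rewrite /cell_start; lia.
- by rewrite size_knots //; move: ni; rewrite /nb_splines; lia.
rewrite /in_cell cell_nonempty // knot_cell_start // rx !andTb.
rewrite -addn1 knot_after //; last by lia.
move: rk; rewrite leq_eqVlt => /orP[/eqP -> |rk].
  rewrite brk_last last_knots eqxx andbT.
  by rewrite orbC -le_eqVlt.
rewrite ltNge; apply/orP; left; apply/negP => xr.
by have := rmax r.+1; rewrite rk xr ltnn => /(_ isT).
Qed.

(** The inner knots have multiplicity d - 2, so the pieces of degree d - 2 match at them; each
differentiation costs one degree, which leaves two derivatives in degree d. *)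
Lemma piece_jump a i r : (a <= 2)%N -> (r < k)%N ->
  ((piece t (cell_start r.+1) d i)^`(a) - (piece t (cell_start r) d i)^`(a)).[brk r.+1] = 0.
Proof.
move=> a2 rk; rewrite -derivnB.
pose F p i := piece t (cell_start r.+1) p i - piece t (cell_start r) p i.
rewrite -/(F d i) (_ : d = d - a + a)%N; last by lia.
apply: (derivn_recurrence_root (f := fun p i => p.+1%:R * (t (i + p.+1)%N - t i)^-1)
   (g := fun p i => - (p.+1%:R * (t (i + p.+1).+1 - t i.+1)^-1))) => [p s|s _].
  rewrite /F derivB !deriv_piece ?cell_nonempty ?(ltnW rk) //; try exact: knot_mono.
  by rewrite -!mul_polyC polyCN !polyCM; ring.
rewrite hornerD hornerN; apply/eqP; rewrite subr_eq0; apply/eqP.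
have -> : cell_start r.+1 = (cell_start r + (d - 2))%N by rewrite /cell_start mulSn; lia.
apply: piece_match_knot.
- by move=> u hu; rewrite knot_after // ltnW.
- by rewrite knot_cell_start ?brk_lt // ltnW.
- have -> : (cell_start r + (d - 2)).+1 = (cell_start r.+1 + 1)%N.
    by rewrite /cell_start mulSn; lia.
  by rewrite knot_after ?brk_lt //; lia.
- by lia.
Qed.

Lemma dspline_continuous a i : (a <= 2)%N -> continuous (dspline a i).
Proof. by move=> a2; apply: glue_continuous => r; exact: piece_jump. Qed.

Lemma is_derive_dspline a i x : (a < 2)%N -> is_derive x (1 : R) (dspline a i) (dspline a.+1 i x).
Proof.
move=> a2; rewrite /dspline.
apply: is_derive_glue => r rk; [|rewrite -!derivnS]; apply: piece_jump => //; exact: ltnW.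
Qed.

(** Only the B-spline of index 0 is nonzero at 0, and each differentiation admits one more
index, since it expresses a spline by two of the next lower degree. *)
Lemma dspline_at0 a i : (a <= 2)%N -> (a < i)%N -> dspline a i 0 = 0.
Proof.
move=> a2 ai; have b0 : brk 0 = 0 by rewrite /brk mul0r.
rewrite /dspline (glue_cell brk_mono _ (leq0n k)) //; last first.
  by rewrite -[X in X < _]b0 brk_lt implybT.
have ad : (a <= d)%N by lia.
rewrite -[X in piece _ _ X _](subnK ad).
apply: (derivn_recurrence_root (F := piece t (cell_start 0))) => [p j|s /andP[si _]].
  rewrite deriv_piece ?cell_nonempty //; last exact: knot_mono.
  by rewrite scalerBr !scalerA -scaleNr.
rewrite (@piece_at_left _ _ _ d) //; rewrite /cell_start ?mul0n ?addn0 //.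
- by case: eqP => //; lia.
- by move=> u ud; rewrite knot0 // leq_subr.
- have -> : t d.+1 = brk 1; last by rewrite -[X in X < _]b0 brk_lt.
  by rewrite -(@knot_after 0 1) ?/cell_start ?mul0n ?addn0 ?addn1 //; lia.
- by lia.
Qed.

Lemma dspline_at1 a i : (a <= 2)%N -> (i + a < cell_start k)%N -> dspline a i 1 = 0.
Proof.
move=> a2 ai.
rewrite /dspline (glue_cell brk_mono _ (leqnn k)) ?ltnn //; last first.
  by rewrite -brk_last brk_mono ?implybT.
have ad : (a <= d)%N by lia.
rewrite -[X in piece _ _ X _](subnK ad).
apply: (derivn_recurrence_root (F := piece t (cell_start k))) => [p j|s /andP[_ si]].
  rewrite deriv_piece ?cell_nonempty //; last exact: knot_mono.
  by rewrite scalerBr !scalerA -scaleNr.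
rewrite (@piece_at_right _ _ _ d); last by lia.
- by case: eqP => //; lia.
- by move=> u /andP[u0 _]; rewrite knot_last // -[X in (X < _)%N]addn0 ltn_add2l.
- by rewrite knot_cell_start // -brk_last brk_lt.
Qed.

(** Every B-spline is active on some nondegenerate knot interval, where local linear
independence applies. *)
Lemma bspline_free (c : nat -> R) :
  (forall x, 0 <= x <= 1 -> \sum_(i < nb_splines d k) c i * bspline (knots R d k) d i x = 0) ->
  forall i, (i < nb_splines d k)%N -> c i = 0.
Proof.
move=> S0 i ni.
(* The first knot interval at or after position i that is nondegenerate. *)
pose r := ((i - d + (d - 3)) %/ (d - 2))%N.
have [r1 r2] : (i - d <= r * (d - 2))%N /\ (r * (d - 2) <= i - d + (d - 3))%N.
  have := divn_eq (i - d + (d - 3)) (d - 2).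
  have := @ltn_pmod (i - d + (d - 3)) (d - 2) ltac:(lia).
  by rewrite -/r; move: (r * (d - 2))%N (_ %% _)%N => y z; lia.
have rk : (r <= k)%N.
  rewrite -ltnS /r ltn_divLR; last by lia.
  by move: ni; rewrite /nb_splines mulSn; move: (k * _)%N => y; lia.
have : (i <= cell_start r <= i + d)%N.
  have [id|di] := leqP i d; last by rewrite /cell_start; move: (r * _)%N r1 r2 => y; lia.
  by rewrite /cell_start /r (eqP id) divn_small; lia.
apply: (piece_free (M := nb_splines d k) (@knot_mono R d k d3) (cell_nonempty rk)).
  by rewrite /cell_start /nb_splines ltnS leq_addr leq_add2l leq_mul2r rk orbT.
apply: (@poly_eq0_on_itv _ _ (brk r) (brk r.+1)); first by rewrite brk_lt.
move=> x /andP[rx xr].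
have x01 : 0 <= x <= 1.
  rewrite (le_trans _ rx) ?divr_ge0 //= (le_trans (ltW xr)) // -brk_last.
  exact: brk_mono.
rewrite -(S0 x) // horner_sum; apply: eq_bigr => j _.
rewrite hornerZ bsplineE // /dspline (glue_cell brk_mono _ rk) ?rx ?xr ?implybT //.
Qed.

End SplineBasis.

(** * Chain rule along curves *)

Section CurveCalculus.
Variable R : realType.
Implicit Types (F g : R * R -> R) (u : R * R) (Z : set (R * R)).
Local Notation S := (@unit_square R).

(** The chain rule along differentiable curves is taken as definition of the gradient: it is
what composition with the inverse of a parametrisation needs, and it is stable under
sums, products and inverses. *)
Definition grad u F (g1 g2 : R) : Prop := forall (h1 h2 : R -> R) (d1 d2 : R),
  h1 0 = u.1 -> h2 0 = u.2 -> is_derive (0 : R) (1 : R) h1 d1 -> is_derive (0 : R) (1 : R) h2 d2 ->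
  is_derive (0 : R) (1 : R) (fun s => F (h1 s, h2 s)) (g1 * d1 + g2 * d2).

Lemma grad_cst u (a : R) : grad u (cst a) 0 0.
Proof. by move=> h1 h2 d1 d2 _ _ _ _; rewrite !mul0r addr0; exact: is_derive_cst. Qed.

Lemma grad_fst u : grad u fst 1 0.
Proof. by move=> h1 h2 d1 d2 _ _ D1 _; rewrite mul0r addr0 mul1r. Qed.

Lemma grad_snd u : grad u snd 0 1.
Proof. by move=> h1 h2 d1 d2 _ _ _ D2; rewrite mul0r add0r mul1r. Qed.

Lemma gradD u F (F1 F2 : R) g (g1 g2 : R) : grad u F F1 F2 -> grad u g g1 g2 ->
  grad u (fun v => F v + g v) (F1 + g1) (F2 + g2).
Proof.
move=> hF hg h1 h2 d1 d2 e1 e2 D1 D2.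
by apply: is_derive_eq; [exact: is_deriveD (hF _ _ _ _ e1 e2 D1 D2) (hg _ _ _ _ e1 e2 D1 D2)|ring].
Qed.

Lemma gradM u F (F1 F2 : R) g (g1 g2 : R) : grad u F F1 F2 -> grad u g g1 g2 ->
  grad u (fun v => F v * g v) (F1 * g u + F u * g1) (F2 * g u + F u * g2).
Proof.
move=> hF hg h1 h2 d1 d2 e1 e2 D1 D2.
apply: is_derive_eq; first exact: is_deriveM (hF _ _ _ _ e1 e2 D1 D2) (hg _ _ _ _ e1 e2 D1 D2).
have e : (h1 0, h2 0) = u by rewrite e1 e2 -surjective_pairing.
by rewrite /GRing.scale /= !e; ring.
Qed.

Lemma gradV u F (F1 F2 : R) : F u != 0 -> grad u F F1 F2 ->
  grad u (fun v => (F v)^-1) (- F1 * (F u)^-1 * (F u)^-1) (- F2 * (F u)^-1 * (F u)^-1).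
Proof.
move=> Fu hF h1 h2 d1 d2 e1 e2 D1 D2.
have [dF vF] := hF _ _ _ _ e1 e2 D1 D2.
have F0 : F (h1 0, h2 0) != 0 by rewrite e1 e2 -surjective_pairing.
split; first exact: derivableV.
rewrite (deriveV F0 dF) vF e1 e2 -surjective_pairing /GRing.scale /=.
by rewrite -exprVn; ring.
Qed.

Lemma grad_tensor u (f f' g g' : R -> R) :
  (forall x, is_derive x (1 : R) f (f' x)) -> (forall x, is_derive x (1 : R) g (g' x)) ->
  grad u (fun v => f v.1 * g v.2) (f' u.1 * g u.2) (f u.1 * g' u.2).
Proof.
move=> hf hg h1 h2 d1 d2 e1 e2 D1 D2.
have Df := @is_derive1_comp _ f h1 0 _ _ (hf (h1 0)) D1.
have Dg := @is_derive1_comp _ g h2 0 _ _ (hg (h2 0)) D2.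
apply: is_derive_eq (is_deriveM Df Dg) _.
by rewrite /GRing.scale /= e1 e2; ring.
Qed.

(** C^n on the unit square, with all derivatives up to order n vanishing on Z. Carrying the zero
set along with the regularity lets one induction show both that the Hessian of a function
exists in the physical plane and that it vanishes on a side. *)
Fixpoint smooth Z (n : nat) F : Prop :=
  [/\ forall u, S u -> {for u, continuous F}, forall u, Z u -> F u = 0
    & if n is m.+1 then exists F1 F2, [/\ smooth Z m F1, smooth Z m F2
          & forall u, S u -> grad u F (F1 u) (F2 u)] else True].

Lemma smoothS Z n F : smooth Z n.+1 F -> smooth Z n F.
Proof.
elim: n F => [|n IH] F [cF zF [F1 [F2 [s1 s2 g]]]]; first by [].
by split=> //; exists F1, F2; split => //; apply: IH.
Qed.

Lemma smooth_cont Z n F u : smooth Z n F -> S u -> {for u, continuous F}.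
Proof. by case: n => [|n] [+ _ _]; exact. Qed.

Lemma smooth_zero Z n F u : smooth Z n F -> Z u -> F u = 0.
Proof. by case: n => [|n] [_ + _]; exact. Qed.

Lemma smooth0 Z n : smooth Z n (cst 0).
Proof.
elim: n => [|n IH]; split => //; try by move=> u _; exact: cst_continuous.
by exists (cst 0), (cst 0); split => // u _; exact: grad_cst.
Qed.

Lemma smooth_cst n a : smooth set0 n (cst a).
Proof.
case: n => [|n]; split => //; try by move=> u _; exact: cst_continuous.
by exists (cst 0), (cst 0); split => [||u _]; [exact: smooth0..|exact: grad_cst].
Qed.

Lemma smooth_fst n : smooth set0 n fst.
Proof.
case: n => [|n]; split => //; try by move=> u _; exact: cvg_fst.
by exists (cst 1), (cst 0); split => [||u _]; [exact: smooth_cst..|exact: grad_fst].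
Qed.

Lemma smooth_snd n : smooth set0 n snd.
Proof.
case: n => [|n]; split => //; try by move=> u _; exact: cvg_snd.
by exists (cst 0), (cst 1); split => [||u _]; [exact: smooth_cst..|exact: grad_snd].
Qed.

Lemma smoothD Z n F g : smooth Z n F -> smooth Z n g -> smooth Z n (fun u => F u + g u).
Proof.
elim: n F g => [|n IH] F g sF sg; split => //.
- by move=> u Su; apply: cvgD; [exact: smooth_cont sF Su|exact: smooth_cont sg Su].
- by move=> u Zu; rewrite (smooth_zero sF Zu) (smooth_zero sg Zu) addr0.
- by move=> u Su; apply: cvgD; [exact: smooth_cont sF Su|exact: smooth_cont sg Su].
- by move=> u Zu; rewrite (smooth_zero sF Zu) (smooth_zero sg Zu) addr0.
case: sF sg => _ _ [F1 [F2 [sF1 sF2 gF]]] [_ _ [g1 [g2 [sg1 sg2 gg]]]].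
exists (fun u => F1 u + g1 u), (fun u => F2 u + g2 u).
by split=> [||u Su]; [exact: IH..|apply: gradD; auto].
Qed.

(** Only the first factor vanishes on Z; the second one stands for the coefficients produced by
a change of variables. *)
Lemma smoothM Z n F g : smooth Z n F -> smooth set0 n g -> smooth Z n (fun u => F u * g u).
Proof.
elim: n F g => [|n IH] F g sF sg; split => //.
- by move=> u Su; apply: cvgM; [exact: smooth_cont sF Su|exact: smooth_cont sg Su].
- by move=> u Zu; rewrite (smooth_zero sF Zu) mul0r.
- by move=> u Su; apply: cvgM; [exact: smooth_cont sF Su|exact: smooth_cont sg Su].
- by move=> u Zu; rewrite (smooth_zero sF Zu) mul0r.
have [sF' sg'] := (smoothS sF, smoothS sg).
case: sF sg => _ _ [F1 [F2 [sF1 sF2 gF]]] [_ _ [g1 [g2 [sg1 sg2 gg]]]].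
exists (fun u => F1 u * g u + F u * g1 u), (fun u => F2 u * g u + F u * g2 u).
by split=> [||u Su]; [apply: smoothD; exact: IH..|apply: gradM; auto].
Qed.

Lemma smoothV n g : (forall u, S u -> g u != 0) -> smooth set0 n g ->
  smooth set0 n (fun u => (g u)^-1).
Proof.
move=> g0; elim: n => [|n IH] sg; split => //.
- by move=> u Su; apply: cvgV; [exact: g0|exact: smooth_cont sg Su].
- by move=> u Su; apply: cvgV; [exact: g0|exact: smooth_cont sg Su].
have sg' := smoothS sg.
case: sg => _ _ [g1 [g2 [sg1 sg2 gg]]].
exists (fun u => - g1 u * (g u)^-1 * (g u)^-1), (fun u => - g2 u * (g u)^-1 * (g u)^-1).
have sN h : smooth set0 n h -> smooth set0 n (fun u => - h u).
  by move=> sh; rewrite (_ : (fun u => _) = (fun u => h u * cst (-1) u));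
    [apply: smoothM => //; exact: smooth_cst|apply/funext => u; rewrite mulrN1].
by split=> [||u Su]; [do 2 (apply: smoothM; last exact: IH); exact: sN..|apply: gradV; auto].
Qed.

Lemma smooth_sum Z n (I : Type) (r : seq I) (F : I -> R * R -> R) :
  (forall i, smooth Z n (F i)) -> smooth Z n (fun u => \sum_(i <- r) F i u).
Proof.
move=> sF; elim: r => [|i r IH].
  by rewrite (_ : (fun u => _) = cst 0); [exact: smooth0|apply/funext => u; rewrite big_nil].
rewrite (_ : (fun u => _) = (fun u => F i u + \sum_(i <- r) F i u)); first exact: smoothD.
by apply/funext => u; rewrite big_cons.
Qed.

End CurveCalculus.

(** * Inverse of a bilinear map *)

(** The corner values have one sign and each value is a convex combination of them. *)
Lemma affine_bounded_away (R : realFieldType) (j j1 j2 : R) :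
  (forall s t, 0 <= s <= 1 -> 0 <= t <= 1 -> j + s * j1 + t * j2 != 0) ->
  exists2 m, 0 < m & forall s t, 0 <= s <= 1 -> 0 <= t <= 1 -> m <= `|j + s * j1 + t * j2|.
Proof.
have i0 : 0 <= (0 : R) <= 1 by rewrite lexx ler01.
have i1 : 0 <= (1 : R) <= 1 by rewrite lexx ler01.
wlog j0 : j j1 j2 / 0 < j => [hw|] h.
  have := h 0 0 i0 i0; rewrite !mul0r !addr0 neq_lt => /orP[jn|/hw]; last exact.
  have [||m m0 hm] := hw (- j) (- j1) (- j2); first by rewrite oppr_gt0.
    by move=> s t hs ht; rewrite !mulrN -!opprD oppr_eq0 h.
  by exists m => // s t hs ht; have := hm s t hs ht; rewrite !mulrN -!opprD normrN.
(* an affine function of one variable without zero on [0, 1] keeps its sign *)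
have root (x y : R) : 0 < x -> (forall s, 0 <= s <= 1 -> x + s * y != 0) -> 0 < x + y.
  move=> x0 hs; rewrite ltNge; apply/negP => xy.
  have y0 : y < 0 by lra.
  have xy01 : 0 <= x / - y <= 1.
    by apply/andP; split; [rewrite divr_ge0|rewrite ler_pdivrMr]; lra.
  have := hs _ xy01; rewrite invrN mulrN mulNr divfK ?subrr ?eqxx //; lra.
have p1 : 0 < j + j1.
  by apply: root => // s hs; have := h s 0 hs i0; rewrite mul0r addr0.
have p2 : 0 < j + j2.
  by apply: root => // s hs; have := h 0 s i0 hs; rewrite mul0r addr0.
have p3 : 0 < j + j1 + j2.
  by apply: root => // s hs; have := h 1 s i1 hs; rewrite mul1r.
exists (Num.min (Num.min j (j + j1)) (Num.min (j + j2) (j + j1 + j2))).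
  by rewrite !lt_min j0 p1 p2 p3.
move=> s t hs ht; set m := Num.min _ _.
have /and4P[m1 m2 m3 m4] : [&& m <= j, m <= j + j1, m <= j + j2 & m <= j + j1 + j2].
  by rewrite /m !ge_min !lexx !orbT.
apply: le_trans (ler_norm _).
have : 0 <= (1 - s) * (1 - t) * (j - m) + s * (1 - t) * (j + j1 - m) +
   (1 - s) * t * (j + j2 - m) + s * t * (j + j1 + j2 - m).
  by rewrite !addr_ge0 // !mulr_ge0 //; lra.
lra.
Qed.

Lemma derive_along_line (R : realType) (g : R * R -> R) (a x : R * R) (l : R) :
  is_derive (0 : R) (1 : R) (fun s => g (s *: a + x)) l -> 'D_a g x = l.
Proof.
move=> [_ <-]; rewrite /derive; congr (lim (_ @ 0^')); apply/funext => h /=.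
by rewrite addr0 scale0r add0r [h *: 1]mulr1.
Qed.

Lemma is_derive_quotient (R : realType) (f : R -> R) (l : R) :
  (fun h => h^-1 * (f h - f 0)) @ 0^' --> l -> is_derive (0 : R) (1 : R) f l.
Proof.
move=> q; have q' : (fun h : R => h^-1 *: ((f \o shift 0) (h *: 1) - f 0)) @ 0^' --> l.
  by rewrite [X in X @ _](_ : _ = (fun h => h^-1 * (f h - f 0))) //; apply/funext => h /=;
    rewrite addr0 [h *: 1]mulr1.
by split; [apply/cvg_ex; exists l|exact: cvg_lim q'].
Qed.

Lemma smooth_affine (R : realType) n (k k1 k2 : R) (F : R * R -> R) :
  (forall u, F u = k + u.1 * k1 + u.2 * k2) ->
  smooth set0 n F.
Proof.
move=> FE; rewrite (_ : F = fun u => cst k u + u.1 * cst k1 u + u.2 * cst k2 u); last exact/funext.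
apply: smoothD; first apply: smoothD; first exact: smooth_cst.
  by apply: smoothM; [exact: smooth_fst|exact: smooth_cst].
by apply: smoothM; [exact: smooth_snd|exact: smooth_cst].
Qed.

Lemma det2_cvg0 (R : realType) (w x : R * R) : det2 (y - x) w @[y --> x] --> (0 : R).
Proof.
have -> : (fun y => det2 (y - x) w) =
  (fun y : R * R => (y.1 - x.1) * w.2 - (y.2 - x.2) * w.1) by [].
rewrite -[X in _ --> X](_ : (x.1 - x.1) * w.2 - (x.2 - x.2) * w.1 = 0); last first.
  by rewrite !subrr !mul0r subrr.
by apply: cvgB; apply: cvgMr_tmp; apply: cvgB;
  [exact: cvg_fst|exact: cvg_cst|exact: cvg_snd|exact: cvg_cst].
Qed.

Section BilinearInverse.
Variables (R : realType) (G : R * R -> R * R) (p b c e : R * R).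
Hypothesis GE : forall u, G u = p + u.1 *: b + u.2 *: c + (u.1 * u.2) *: e.
Implicit Types (a u v x y : R * R) (Z : set (R * R)) (F g : R * R -> R).
Local Notation S := (@unit_square R).
Local Notation A := (G @` S).

Definition tangent1 u := b + u.2 *: e.
Definition tangent2 u := c + u.1 *: e.
Definition jac u := det2 (tangent1 u) (tangent2 u).

Lemma derive_bilinear1 u : 'D_(e1 R) G u = tangent1 u.
Proof.
apply: cvg_lim => //.
apply: (@cvg_trans _ (cst (tangent1 u) @ 0^')); last exact: cvg_cst.
apply: near_eq_cvg; near=> h.
have h0 : h != 0 by near: h; exact: nbhs_dnbhs_neq.
rewrite /= !GE /tangent1 /e1.
by apply/pair_equal_spec; split; rewrite /= /GRing.scale /=; field.
Unshelve. all: by end_near.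
Qed.

Lemma derive_bilinear2 u : 'D_(e2 R) G u = tangent2 u.
Proof.
apply: cvg_lim => //.
apply: (@cvg_trans _ (cst (tangent2 u) @ 0^')); last exact: cvg_cst.
apply: near_eq_cvg; near=> h.
have h0 : h != 0 by near: h; exact: nbhs_dnbhs_neq.
rewrite /= !GE /tangent2 /e2.
by apply/pair_equal_spec; split; rewrite /= /GRing.scale /=; field.
Unshelve. all: by end_near.
Qed.

(** The difference of two values of a bilinear map factors through a matrix whose
determinant is exactly a value of the Jacobian at a point of the square, also for distant u, v. *)
Lemma bilinear_diff1 u v : det2 (G u - G v) (tangent2 v) = (u.1 - v.1) * jac (v.1, u.2).
Proof. by rewrite /jac /det2 !GE /tangent1 /tangent2 /= /GRing.scale /=; ring. Qed.

Lemma bilinear_diff2 u v : det2 (tangent1 v) (G u - G v) = (u.2 - v.2) * jac (u.1, v.2).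
Proof. by rewrite /jac /det2 !GE /tangent1 /tangent2 /= /GRing.scale /=; ring. Qed.

Lemma jacE u : jac u = det2 b c + u.1 * det2 b e + u.2 * det2 e c.
Proof. by rewrite /jac /det2 /tangent1 /tangent2 /= /GRing.scale /=; ring. Qed.

Hypothesis jac_neq0 : forall u, S u -> jac u != 0.

Lemma jac_bounded_away : exists2 m, 0 < m & forall u, S u -> m <= `|jac u|.
Proof.
have [s t hs ht|m m0 hm] := @affine_bounded_away R (det2 b c) (det2 b e) (det2 e c).
  by rewrite -(jacE (s, t)) jac_neq0.
by exists m => // u [hs ht]; rewrite jacE hm.
Qed.

Variable H : R * R -> R * R.
Hypothesis HK : forall u, S u -> H (G u) = u.


Lemma inverse_continuous u : S u -> H @ within A (nbhs (G u)) --> u.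
Proof.
move=> Su; have [m m0 hm] := jac_bounded_away.
have near_le (w : R * R) (f : R * R -> R) :
    (forall v, S v -> m * `|f v - f u| <= `|det2 (G v - G u) w|) ->
    f (H y) @[y --> within A (nbhs (G u))] --> f u.
  move=> hf; apply/cvgrPdist_le => eps eps0; rewrite near_withinE.
  have /cvgr0Pnorm_le/(_ (m * eps) (mulr_gt0 m0 eps0)) := @det2_cvg0 R w (G u).
  apply: filterS => y hy [v Sv vy]; rewrite -vy HK // distrC -(ler_pM2l m0).
  by apply: le_trans (hf v Sv) _; rewrite vy.
rewrite [X in _ --> X]surjective_pairing.
rewrite (_ : H = fun y => ((H y).1, (H y).2)); last by apply/funext => y; exact: surjective_pairing.
apply: (@cvg_pair _ _ _ _ (nbhs u.1) (nbhs u.2) _ _ _ (fun y => (H y).1) (fun y => (H y).2)).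
  apply: (near_le (tangent2 u) fst) => v Sv.
  rewrite bilinear_diff1 normrM mulrC ler_wpM2l // hm //.
  by case: Su Sv => [u1 u2] [v1 v2].
apply: (near_le (- tangent1 u) snd) => v Sv.
have -> : det2 (G v - G u) (- tangent1 u) = det2 (tangent1 u) (G v - G u).
  by rewrite /det2 /=; ring.
rewrite bilinear_diff2 normrM mulrC ler_wpM2l // hm //.
by case: Su Sv => [u1 u2] [v1 v2].
Qed.

Lemma line_cvg a x : s *: a + x @[s --> (0 : R)] --> x.
Proof.
rewrite -[X in _ --> X](_ : 0 *: a + x = x); last by rewrite scale0r add0r.
by apply: cvgD; [apply: cvgZr_tmp; exact: cvg_id|exact: cvg_cst].
Qed.

Lemma near_line a x : A° x -> \forall s \near (0 : R), A° (s *: a + x).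
Proof.
by move=> Ax; apply: (@line_cvg a x); apply: open_nbhs_nbhs; split => //; exact: open_interior.
Qed.

Lemma inverse_line_cvg a u : S u -> A° (G u) -> H (s *: a + G u) @[s --> (0 : R)] --> u.
Proof.
move=> Su Au P /(inverse_continuous Su) hP.
have near_imp : \forall s \near (0 : R), A (s *: a + G u) -> P (H (s *: a + G u)).
  exact: (@line_cvg a (G u)) hP.
apply: filterS2 near_imp (near_line a Au) => s h /interior_subset; exact: h.
Qed.

Lemma smooth_jacV n : smooth set0 n (fun u => (jac u)^-1).
Proof. by apply: smoothV => //; apply: smooth_affine => u; exact: jacE. Qed.

Lemma jac_line_cvg a u (k : R * R -> R * R) :
  S u -> A° (G u) -> {for u, continuous k} -> k u = u ->
  (jac (k (H (s *: a + G u))))^-1 @[s --> 0^'] --> (jac u)^-1.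
Proof.
move=> Su Au kc ku.
have cj : {for u, continuous jac}.
  by apply: (@smooth_cont _ set0 0) => //; apply: smooth_affine => v; exact: jacE.
have ck : k (H (s *: a + G u)) @[s --> (0 : R)] --> u.
  rewrite -[X in _ --> X]ku; exact: (cvg_comp _ _ (@inverse_line_cvg a u Su Au) kc).
apply: cvgV; first exact: jac_neq0.
by apply: cvg_within_filter; exact: (cvg_comp _ _ ck cj).
Qed.

(** By bilinear_diff1 the difference quotient is exactly a constant over a value of the
Jacobian, so that the derivative comes from the continuity of the inverse alone. *)
Lemma is_derive_inverse1 a u : S u -> A° (G u) ->
  is_derive (0 : R) (1 : R) (fun s => (H (s *: a + G u)).1) (det2 a (tangent2 u) / jac u).
Proof.
move=> Su Au; apply: is_derive_quotient; rewrite scale0r add0r HK //.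
apply: (@cvg_trans _ (det2 a (tangent2 u) / jac (u.1, (H (s *: a + G u)).2) @[s --> 0^'])).
  apply: near_eq_cvg; near=> s.
  have s0 : s != 0 by near: s; exact: nbhs_dnbhs_neq.
  have [v Sv vs] : A (s *: a + G u).
    by apply: interior_subset; near: s; apply: nbhs_dnbhs; exact: near_line.
  have j0 : jac (u.1, v.2) != 0.
    by apply: jac_neq0; case: Su Sv => [u1 u2] [v1 v2].
  rewrite -vs HK //; have := bilinear_diff1 v u; rewrite vs addrK => d.
  apply: (mulIf j0); rewrite divfK // -mulrA -d /det2 /= /GRing.scale /=.
  by field.
apply: cvgM; first exact: cvg_cst.
apply: (@jac_line_cvg _ _ (fun v => (u.1, v.2))) => //; last by rewrite -surjective_pairing.
apply: (@cvg_pair _ _ _ _ (nbhs u.1) (nbhs u.2) _ _ _ (fun=> u.1) snd);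
  [exact: cvg_cst|exact: cvg_snd].
Unshelve. all: by end_near.
Qed.

Lemma is_derive_inverse2 a u : S u -> A° (G u) ->
  is_derive (0 : R) (1 : R) (fun s => (H (s *: a + G u)).2) (det2 (tangent1 u) a / jac u).
Proof.
move=> Su Au; apply: is_derive_quotient; rewrite scale0r add0r HK //.
apply: (@cvg_trans _ (det2 (tangent1 u) a / jac ((H (s *: a + G u)).1, u.2) @[s --> 0^'])).
  apply: near_eq_cvg; near=> s.
  have s0 : s != 0 by near: s; exact: nbhs_dnbhs_neq.
  have [v Sv vs] : A (s *: a + G u).
    by apply: interior_subset; near: s; apply: nbhs_dnbhs; exact: near_line.
  have j0 : jac (v.1, u.2) != 0.
    by apply: jac_neq0; case: Su Sv => [u1 u2] [v1 v2].
  rewrite -vs HK //; have := bilinear_diff2 v u; rewrite vs addrK => d.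
  apply: (mulIf j0); rewrite divfK // -mulrA -d /det2 /= /GRing.scale /=.
  by field.
apply: cvgM; first exact: cvg_cst.
apply: (@jac_line_cvg _ _ (fun v => (v.1, u.2))) => //; last by rewrite -surjective_pairing.
apply: (@cvg_pair _ _ _ _ (nbhs u.1) (nbhs u.2) _ _ _ fst (fun=> u.2));
  [exact: cvg_fst|exact: cvg_cst].
Unshelve. all: by end_near.
Qed.

Lemma derive_inverse_comp a g F u (F1 F2 : R) : S u -> A° (G u) ->
  (forall y, A° y -> g y = F (H y)) -> grad u F F1 F2 ->
  'D_a g (G u) = F1 * (det2 a (tangent2 u) / jac u) + F2 * (det2 (tangent1 u) a / jac u).
Proof.
move=> Su Au gF gradF; apply: derive_along_line.
apply: (@near_eq_is_derive _ _ _ (fun s : R => F ((H (s *: a + G u)).1, (H (s *: a + G u)).2))).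
  by near=> s; rewrite -surjective_pairing gF //; near: s; exact: near_line.
apply: gradF; rewrite ?scale0r ?add0r ?HK //.
  exact: is_derive_inverse1.
exact: is_derive_inverse2.
Unshelve. all: by end_near.
Qed.

(** A directional derivative of F o G^-1 has again the form F' o G^-1, with F' one order less
smooth and vanishing where F and its derivatives do. Iterating gives the Hessian. *)
Lemma smooth_derive Z n F a : smooth Z n.+1 F -> exists2 F', smooth Z n F' &
  forall g, (forall y, A° y -> g y = F (H y)) -> forall y, A° y -> 'D_a g y = F' (H y).
Proof.
move=> [_ _ [F1 [F2 [sF1 sF2 gF]]]].
exists (fun u => F1 u * (det2 a (tangent2 u) / jac u) + F2 u * (det2 (tangent1 u) a / jac u)).
  apply: smoothD; apply: smoothM => //; apply: smoothM; try exact: smooth_jacV.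
    apply: (@smooth_affine _ _ (det2 a c) (det2 a e) 0) => u.
    by rewrite /det2 /tangent2 /= /GRing.scale /=; ring.
  apply: (@smooth_affine _ _ (det2 b a) 0 (det2 e a)) => u.
  by rewrite /det2 /tangent1 /= /GRing.scale /=; ring.
move=> g ge y Ay; have [u Su uy] := interior_subset Ay.
by rewrite -uy (derive_inverse_comp a Su _ ge (gF u Su)) ?HK // uy.
Qed.

Lemma smooth_trace Z n F g u : smooth Z n F -> (forall y, A° y -> g y = F (H y)) ->
  Z u -> S u -> g @ within A° (nbhs (G u)) --> (0 : R).
Proof.
move=> sF gF Zu Su; rewrite -(smooth_zero sF Zu).
move=> P /(smooth_cont sF Su) /(inverse_continuous Su) hP.
have {}hP : \forall y \near G u, A y -> P (F (H y)) by exact: hP.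
suff : \forall y \near G u, A° y -> P (g y) by [].
by apply: filterS hP => y h Ay; rewrite gF //; apply: h; exact: interior_subset.
Qed.

End BilinearInverse.

(** * Vertices and edges of a patch *)

Section Segments.
Variables (R : realType).
Implicit Types A B C D : R * R.

Definition segment A B : set (R * R) := [set x | exists2 t, 0 <= t <= 1 & x = A + t *: (B - A)].

(** A segment remembers its endpoints: writing the direction vectors as multiples of each
other, with factors of absolute value at most 1 and product 1, leaves only plus or minus 1. *)
Lemma segment_endpoints A B C D : A != B -> segment A B = segment C D ->
  (A = C \/ A = D) /\ (B = C \/ B = D).
Proof.
move=> AB e.
have [s s01 As] : segment C D A by rewrite -e; exists 0; rewrite ?lexx ?ler01 // scale0r addr0.
have [t t01 Bt] : segment C D B by rewrite -e; exists 1; rewrite ?lexx ?ler01 // scale1r addrC subrK.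
have [s' s'01 Cs] : segment A B C by rewrite e; exists 0; rewrite ?lexx ?ler01 // scale0r addr0.
have [t' t'01 Dt] : segment A B D by rewrite e; exists 1; rewrite ?lexx ?ler01 // scale1r addrC subrK.
have BA : B - A = (t - s) *: (D - C) by rewrite {1}Bt {1}As opprD addrACA subrr add0r scalerBl.
have DC : D - C = (t' - s') *: (B - A) by rewrite {1}Dt {1}Cs opprD addrACA subrr add0r scalerBl.
(* B - A and D - C are multiples of each other by factors that both lie in [-1, 1]. *)
have st1 : (t - s) * (t' - s') = 1.
  have : ((t - s) * (t' - s') - 1) *: (B - A) = 0.
    by rewrite scalerBl scale1r -scalerA -DC -BA subrr.
  by move/eqP; rewrite scaler_eq0 [B - A == 0]subr_eq0 [B == A]eq_sym (negbTE AB) orbF;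
    rewrite subr_eq0 => /eqP.
have [[s0 t1]|[s1 t0]] : (s = 0 /\ t = 1) \/ (s = 1 /\ t = 0).
  have [ts|ts] := leP s t; [left|right].
    have : t - s = 1 by nra.
    by move=> h; split; lra.
  have : t - s = -1 by nra.
  by move=> h; split; lra.
by split; [left; rewrite As s0 scale0r addr0|right; rewrite Bt t1 scale1r addrC subrK].
by split; [right; rewrite As s1 scale1r addrC subrK|left; rewrite Bt t0 scale0r addr0].
Qed.
End Segments.

Section MeshTheory.
Variables (R : realType) (P : nat) (G : 'I_P -> R * R -> R * R).
Hypothesis hG : multipatch_domain G.
Implicit Types (l : 'I_P) (p q s : bool * bool) (x : R * R).
Local Notation S := (@unit_square R).
Local Notation corner := (fun p : bool * bool => (p.1%:R, p.2%:R) : R * R).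

Lemma patch_map_inj l u v : S u -> S v -> G l u = G l v -> u = v.
Proof.
move=> Su Sv e; have [_ inj _] := patch_bijective hG l.
by apply: inj => //; rewrite inE.
Qed.

Lemma bool01 (b : bool) : 0 <= (b%:R : R) <= 1.
Proof. by case: b; rewrite ?lexx ler01. Qed.

Lemma corner_in_square p : S (corner p).
Proof. by split; exact: bool01. Qed.

Lemma vertex_in_patch l p : patch_set G l (vertex G l p).
Proof. by exists (corner p) => //; exact: corner_in_square. Qed.

Lemma edge_sub_patch l s : edge G l s `<=` patch_set G l.
Proof. by move=> _ [u [Su _] <-]; exists u. Qed.

Lemma bool_natr_inj (b b' : bool) : b%:R = b'%:R :> R -> b = b'.
Proof. by move/eqP; rewrite eqr_nat; case: b; case: b'. Qed.

Lemma pair_coord_corner (b : bool) p : pair_coord b (corner p) = (pair_coord b p)%:R.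
Proof. by case: b. Qed.

Lemma vertex_on_edge l s p : edge G l s (vertex G l p) <-> on_side s p.
Proof.
split=> [[u [Su us]] up|/eqP sp]; last first.
  by exists (corner p) => //; split; [exact: corner_in_square|rewrite pair_coord_corner sp].
have uE := patch_map_inj Su (corner_in_square p) up.
by apply/eqP; apply: bool_natr_inj; rewrite -us uE pair_coord_corner.
Qed.

Lemma vertex_inj l : injective (vertex G l).
Proof.
move=> p q /(patch_map_inj (corner_in_square p) (corner_in_square q)) [e1 e2].
by case: p q e1 e2 => [p1 p2] [q1 q2] /= /bool_natr_inj -> /bool_natr_inj ->.
Qed.

Lemma on_side_sub s s' : (forall p, on_side s p -> on_side s' p) -> s = s'.
Proof.
rewrite /on_side.
move=> h; move: (h (false, false)) (h (false, true)) (h (true, false)) (h (true, true)) => {h}.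
by case: s s' => [[] []] [[] []] /= h1 h2 h3 h4 //;
  first [by have := h1 isT|by have := h2 isT|by have := h3 isT|by have := h4 isT].
Qed.

Lemma edge_sub l s s' : edge G l s `<=` edge G l s' -> s = s'.
Proof. by move=> h; apply: on_side_sub => p /(vertex_on_edge l) /h /vertex_on_edge. Qed.

(** The two corners of the side s, for which the free coordinate is 0 and 1. *)
Definition side_start s : bool * bool := if s.1 then (false, s.2) else (s.2, false).
Definition side_end s : bool * bool := if s.1 then (true, s.2) else (s.2, true).

Lemma on_sideP s p : on_side s p -> p = side_start s \/ p = side_end s.
Proof. by case: s p => [[] []] [[] []]; rewrite /on_side /=; auto. Qed.

Lemma on_side_start s : on_side s (side_start s).
Proof. by case: s => [[] []]. Qed.

Lemma on_side_end s : on_side s (side_end s).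
Proof. by case: s => [[] []]. Qed.

Lemma edge_segment l s : edge G l s = segment (vertex G l (side_start s)) (vertex G l (side_end s)).
Proof.
have [a [b [c [e GE]]]] := patch_bilinear hG l.
apply/seteqP; split => x.
  move=> [u [[u1 u2] us] <-]; exists (pair_coord (~~ s.1) u); first by case: s.1.
  move: us; case: s => [[] []] /= us; rewrite /vertex !GE /side_start /side_end /=;
  by apply/pair_equal_spec; split; rewrite /= /GRing.scale /= us; ring.
move=> [t t01 ->]; exists (if s.1 then (t, s.2%:R) else (s.2%:R, t)).
  by case: s => [[] s2] /=; split=> //; split=> //=; exact: bool01.
case: s => [[] []] /=; rewrite /vertex !GE /side_start /side_end /=;
by apply/pair_equal_spec; split; rewrite /= /GRing.scale /=; ring.
Qed.

Lemma edge_endpoint l l' s s' p : edge G l s = edge G l' s' -> on_side s p ->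
  exists2 p', on_side s' p' & vertex G l p = vertex G l' p'.
Proof.
rewrite !edge_segment => e.
have ne : vertex G l (side_start s) != vertex G l (side_end s).
  by apply/eqP => /vertex_inj; case: (s) => [[] []].
have [hA hB] := segment_endpoints ne e.
have hS : exists2 p', on_side s' p' & vertex G l (side_start s) = vertex G l' p'.
  by case: hA => ->; [exists (side_start s')|exists (side_end s')] => //;
    [exact: on_side_start|exact: on_side_end].
have hE : exists2 p', on_side s' p' & vertex G l (side_end s) = vertex G l' p'.
  by case: hB => ->; [exists (side_start s')|exists (side_end s')] => //;
    [exact: on_side_start|exact: on_side_end].
by case/on_sideP => ->.
Qed.

Lemma edges_at_finite x : finite_set (edges_at G x).
Proof.
apply: (@sub_finite_set _ _ [set edge G ls.1 ls.2 | ls in setT]); last first.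
  by apply: finite_image; exact: finite_finset.
by move=> Gam [l [s [p [-> _ _]]]]; exists (l, s).
Qed.

Lemma edge_at l s p : on_side s p -> edges_at G (vertex G l p) (edge G l s).
Proof. by move=> sp; exists l, s, p. Qed.

End MeshTheory.

(** * Neighbours and valency *)

Section Boundary.
Variables (R : realType) (P : nat) (G : 'I_P -> R * R -> R * R).
Hypothesis hG : multipatch_domain G.
Implicit Types (l : 'I_P) (p q s : bool * bool) (x : R * R).
Local Notation S := (@unit_square R).

Lemma card_fset_set_gt2 (T : choiceType) (A : set T) (a b c : T) : finite_set A ->
  A a -> A b -> A c -> a != b -> a != c -> b != c -> (3 <= #|` fset_set A|)%N.
Proof.
move=> fA Aa Ab Ac ab ac bc.
have : ([fset a; b; c] `<=` fset_set A)%fset.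
  apply/fsubsetP => y; rewrite !inE in_fset_set // => /orP[/orP[]|] /eqP ->;
  by rewrite inE.
move/fsubset_leq_card; apply: leq_trans.
by rewrite -fsetUA cardfsU1 cardfs2 !inE (negbTE ab) (negbTE ac) bc.
Qed.

Lemma boundary_sideN l s : ~ boundary_side G l s ->
  exists l' s', l != l' /\ edge G l s = edge G l' s'.
Proof.
move/contrapT => [l1 [l2 [s1 [s2 [l12 e1 e2]]]]].
have [ll1|ll1] := eqVneq l l1; last by exists l1, s1.
by subst l1; exists l2, s2.
Qed.

(** The side through the corner p that is not s. *)
Definition other_side s p : bool * bool := if s.1 then (false, p.1) else (true, p.2).

Lemma on_other_side s p : on_side (other_side s p) p.
Proof. by case: s p => [[] []] [[] []]. Qed.

Lemma other_side_neq s p : other_side s p != s.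
Proof. by case: s p => [[] []] [[] []]. Qed.

(** Three distinct edges end at the vertex: two of the patch itself and the second one of its
neighbour, since two patches have at most one edge in common. *)
Lemma valency_nonboundary l s p : ~ boundary_side G l s -> on_side s p ->
  (3 <= valency G (vertex G l p))%N.
Proof.
move/boundary_sideN => [l' [s' [ll' e]]] sp.
have [p' sp' vp] := edge_endpoint hG e sp.
have fin := edges_at_finite G (vertex G l p).
apply: (@card_fset_set_gt2 _ _ (edge G l s) (edge G l (other_side s p))
  (edge G l' (other_side s' p'))) => //.
- exact: edge_at.
- by apply: edge_at; exact: on_other_side.
- by rewrite vp; apply: edge_at; exact: on_other_side.
- apply/eqP => h; move: (other_side_neq s p); rewrite eq_sym => /eqP; apply.
  by apply: (edge_sub hG (l := l)); rewrite h.
- rewrite e; apply/eqP => h; move: (other_side_neq s' p'); rewrite eq_sym => /eqP; apply.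
  by apply: (edge_sub hG (l := l')); rewrite h.
apply/eqP => h.
have sub t t' : edge G l t = edge G l' t' -> edge G l t `<=` patch_set G l `&` patch_set G l'.
  by move=> ett x hx; split; [|rewrite ett in hx]; exact: edge_sub_patch hx.
have same t t' : edge G l t = edge G l' t' -> t = s.
  move=> ett; case: (patch_intersection hG ll') => [e0|[q [q' [_ eq]]]|[r [r' [_ er]]]].
  - have /sub := ett; rewrite e0 => /(_ (vertex G l (side_start t))) [];
      exact/vertex_on_edge/on_side_start.
  - have /sub := ett; rewrite eq => sb.
    have h1 := sb _ ((vertex_on_edge hG l t _).2 (on_side_start t)).
    have h2 := sb _ ((vertex_on_edge hG l t _).2 (on_side_end t)).
    have := vertex_inj hG (etrans h1 (esym h2)).
    by case: (t) => [[] []].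
  - have := sub _ _ ett; have := sub _ _ e; rewrite er => es et.
    by rewrite (edge_sub hG es) (edge_sub hG et).
by move: (other_side_neq s p); rewrite (same _ _ h) eqxx.
Qed.

Lemma ccw_next_side x l l' k p : ccw_next G x l l' -> k \in [:: l; l'] -> x = vertex G k p ->
  exists2 s, on_side s p & ~ boundary_side G k s.
Proof.
move=> [s [s' [q [q' [[e sq _ _ xq] [ll' _ _]]]]]].
have bd m t : edge G m t = edge G l s -> ~ boundary_side G m t.
  move=> em; rewrite /boundary_side em; apply; exists l, l', s, s'; split => //.
have xe : edge G l s x by rewrite xq; apply/vertex_on_edge.
rewrite !inE => /orP[]/eqP -> xk.
  by exists s; [apply/(vertex_on_edge hG l); rewrite -xk|exact: bd].
by exists s'; [apply/(vertex_on_edge hG l'); rewrite -xk -e|apply: bd; rewrite e].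
Qed.

Lemma sorted_neighbour (T : eqType) (r : rel T) (t : seq T) (a : T) : sorted r t -> a \in t ->
  t = [:: a] \/ exists b c, r b c /\ a \in [:: b; c].
Proof.
elim: t => // b [|c t] IH /=; first by rewrite inE => _ /eqP ->; left.
move=> /andP[bc st]; rewrite inE => /orP[/eqP ->|at_].
  by right; exists b, c; rewrite !inE eqxx.
have [[_ e]|h] := IH st at_; last by right.
by move: at_; rewrite e inE => /eqP ac; right; exists b, c; rewrite !inE ac eqxx orbT.
Qed.

(** Consecutive patches of the fan of a vertex share an edge at it, so a patch with two
boundary sides there has no neighbour in the fan: the fan is that patch alone, and it is not
cyclic. *)
Lemma boundary_corner l p : (forall s, on_side s p -> boundary_side G l s) ->
  valency G (vertex G l p) = 2 /\ forall l', patch_set G l' (vertex G l p) -> l' = l.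
Proof.
move=> hb; set x := vertex G l p.
have mv : mesh_vertex G x by exists l, p.
have [fan [ufan memfan fin fbd]] := vertex_fan hG mv.
have lfan : l \in fan by apply/memfan/vertex_in_patch.
have nb : ~ exists b c, `[< ccw_next G x b c >] /\ l \in [:: b; c].
  move=> [b [c [/asboolP bc lbc]]].
  by have [s sp] := ccw_next_side bc lbc (erefl : x = vertex G l p); apply; exact: hb.
have single (srt : sorted (fun a b => `[< ccw_next G x a b >]) fan) : fan = [:: l].
  by have [//|/nb] := sorted_neighbour srt lfan.
have [inn|out] := pselect (inner_vertex G x).
  have [_ cyc] := fin inn; exfalso.
  case: fan ufan memfan fin fbd lfan single cyc => // a t ufan memfan fin fbd lfan single.
  rewrite /= rcons_path => /andP[pt la].
  have [ea et] := single pt; subst t; apply: nb; exists a, a; split => //.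
  by rewrite ea !inE eqxx.
have [sz srt] := fbd out; have fl := single srt.
split; first by rewrite -sz fl.
by move=> l' /memfan; rewrite fl inE => /eqP.
Qed.

(** A shared point that is only a corner still lies on a side with a neighbour, since otherwise
the patch would be alone there. *)
Lemma shared_point l l' u : l != l' -> S u -> patch_set G l' (G l u) ->
  exists2 s, ~ boundary_side G l s & pair_coord s.1 u = s.2%:R.
Proof.
move=> ll' Su hl'.
have hx : (patch_set G l `&` patch_set G l') (G l u) by split => //; exists u.
case: (patch_intersection hG ll') => [e0|[q [q' [e eq]]]|[r [r' [e er]]]].
- by move: hx; rewrite e0.
- move: hx; rewrite eq => /(patch_map_inj hG Su (corner_in_square R q)) ->.
  apply: contrapT => h.
  have [_ /(_ l')] : valency G (vertex G l q) = 2 /\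
      forall l', patch_set G l' (vertex G l q) -> l' = l.
    apply: boundary_corner => s sq; apply: contrapT => sb; apply: h; exists s => //.
    by rewrite pair_coord_corner; move/eqP: sq => ->.
  rewrite e; move/(_ (vertex_in_patch _ _ _)) => l'l.
  by rewrite l'l eqxx in ll'.
move: hx; rewrite er => -[v [Sv vr] vu].
exists r; last by rewrite -(patch_map_inj hG Sv Su vu).
by apply; exists l, l', r, r'.
Qed.

End Boundary.

(** * Existence of a neighbour *)

Section NonBoundary.
Variables (R : realType) (P : nat) (G : 'I_P -> R * R -> R * R).
Hypothesis hG : multipatch_domain G.
Implicit Types (l : 'I_P) (p q s : bool * bool) (x : R * R).
Local Notation S := (@unit_square R).

Lemma unit_square_compact : compact S.
Proof.
have -> : S = `[0, 1]%classic `*` `[0, 1]%classic.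
  by apply/seteqP; split => u; rewrite /unit_square /setX /= !in_itv /=.
by apply: compact_setX; exact: segment_compact.
Qed.

Lemma patch_closed l : closed (patch_set G l).
Proof.
have [a [b [c [e GE]]]] := patch_bilinear hG l.
apply: compact_closed; first exact: norm_hausdorff.
apply: continuous_compact unit_square_compact; apply: continuous_subspaceT => u.
rewrite (_ : G l = fun u => a + u.1 *: b + u.2 *: c + (u.1 * u.2) *: e); last exact/funext.
apply: cvgD; [apply: cvgD; [apply: cvgD; first exact: cvg_cst|]|]; apply: cvgZr_tmp.
- exact: cvg_fst.
- exact: cvg_snd.
- by apply: cvgM; [exact: cvg_fst|exact: cvg_snd].
Qed.

(** Without a neighbour along any side a patch is disjoint from all others; then the patch minus
a corner is open and closed in the connected domain minus this corner. *)
Lemma exists_nonboundary_side l : exists s, ~ boundary_side G l s.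
Proof.
apply: contrapT => hb.
have disj l' y : l != l' -> patch_set G l y -> patch_set G l' y -> False.
  move=> ll' [u Su <-] /(shared_point hG ll' Su) [s sb _]; apply: hb; exists s; exact: sb.
pose x := vertex G l (false, false); pose B := patch_set G l `\ x.
have mx : mesh_vertex G x by exists l, (false, false).
have DE : mesh_domain G `\ x = B.
  symmetry; apply: (domain_minus_vertex hG mx).
  - exists (vertex G l (true, true)); split; first exact: vertex_in_patch.
    by move=> /(vertex_inj hG).
  - exists (~` \bigcup_(l' in [set l' | l' != l]) patch_set G l').
      apply: closed_openC; apply: closed_bigcup => [|l' _]; last exact: patch_closed.
      exact: finite_finset.
    apply/seteqP; split => y.
      move=> [ly yx]; split; first by split => //; exists l.
      by move=> [l' /= ll' l'y]; apply: (disj l' y) => //; rewrite eq_sym.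
    move=> [[[l' l'y] yx] nl]; split => //.
    by have [<-//|ll'] := eqVneq l' l; exfalso; apply: nl; exists l'.
  exists (patch_set G l); first exact: patch_closed.
  apply/seteqP; split => y; first by move=> [ly yx]; split => //; split => //; exists l.
  by move=> [[_ yx] ly].
have [l' ll'] : exists l', l != l'.
  have P1 := two_patches hG; have P0 := ltnW P1.
  have [la|la] := eqVneq l (Ordinal P0); last by exists (Ordinal P0).
  by exists (Ordinal P1); rewrite la.
have vl' : patch_set G l' (vertex G l' (false, false)) by exact: vertex_in_patch.
have [vl _] : B (vertex G l' (false, false)).
  rewrite -DE; split; first by exists l'.
  move=> vx; apply: (disj l' x ll'); first exact: vertex_in_patch.
  by rewrite -vx.
exact: disj ll' vl vl'.
Qed.
End NonBoundary.

(** * The patch subspace *)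

Section PatchSpace.
Variables (R : realType) (P : nat) (G : 'I_P -> R * R -> R * R) (d k : nat).
Hypotheses (hG : multipatch_domain G) (d3 : (3 <= d)%N).
Implicit Types (l : 'I_P) (p s : bool * bool) (i : spline_index d k).
Local Notation S := (@unit_square R).

Definition far_from (s : bool * bool) i := (3 <= dist_end s.2 (pair_coord s.1 i))%N.

Definition interior_index l i : bool :=
  [forall s, `[< boundary_side G l s >] || far_from s i].

Lemma interior_indexP l i :
  reflect (forall s, ~ boundary_side G l s -> far_from s i) (interior_index l i).
Proof.
apply: (iffP forallP) => h s; first by move=> /asboolPn sb; move: (h s); rewrite (negbTE sb).
by case: asboolP => //= /h.
Qed.

(** The coefficients forced to vanish by the edges and by the vertices of valency at least 3
together form full layers of width 3 along the sides with a neighbour: the ends of a layer,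
absent from the edge sets, are filled in by the corners, and a corner contributes nothing
when both its sides are boundary, because its valency is then 2. *)
Lemma vanishing_index l i :
  (~` @I_patch P d k l `|` @I_Gamma R P G d k `|` @I_Xi R P G d k) (l, i) <-> ~~ interior_index l i.
Proof.
split.
  move=> h; apply/negP => /interior_indexP far; case: h => [[]|].
  - by rewrite /setC /= => h; exact: h.
  - move=> [Gam nbG [s [eG ds _ _]]] /=.
    have sb : ~ boundary_side G l s by rewrite /boundary_side eG; apply.
    by have := far s sb; rewrite /far_from leqNgt ltnS ds.
  move=> [x [_ xval] [p [/= px d1 d2]]].
  have [s sp sb] : exists2 s, on_side s p & ~ boundary_side G l s.
    apply: contrapT => h; have [] := @boundary_corner _ _ _ hG l p.
      by move=> s sp; apply: contrapT => sb; apply: h; exists s.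
    by rewrite px => v2; rewrite v2 in xval.
  have := far s sb; rewrite /far_from -(eqP sp); move: d1 d2.
  by case: (s.1) => /= d1 d2; rewrite leqNgt ltnS ?d1 ?d2.
move=> /interior_indexP h.
have [s [sb ds]] : exists s, ~ boundary_side G l s /\ (dist_end s.2 (pair_coord s.1 i) <= 2)%N.
  apply: contrapT => hs; apply: h => s sb; rewrite /far_from leqNgt; apply/negP => ds.
  by apply: hs; exists s.
have nb : nonboundary_edge G (edge G l s) by exact: contrapT.
have [hin|] := boolP ((3 <= dist_end false (pair_coord (~~ s.1) i))%N
   && (3 <= dist_end true (pair_coord (~~ s.1) i))%N).
  case/andP: hin => h1 h2.
  by left; right; exists (edge G l s) => //; exists s.
rewrite negb_and -!ltnNge !ltnS => hout; right.
have [b db] : exists b, (dist_end b (pair_coord (~~ s.1) i) <= 2)%N.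
  by case/orP: hout; [exists false|exists true].
pose p := if s.1 then (b, s.2) else (s.2, b).
have sp : on_side s p by rewrite /on_side /p; case: s.1.
exists (vertex G l p); first by split; [exists l, p|exact: valency_nonboundary sb sp].
by exists p; rewrite /p; move: ds db; case: s.1.
Qed.

Lemma dspline_far a s i (u : R * R) : (a <= 2)%N -> far_from s i -> pair_coord s.1 u = s.2%:R ->
  dspline d k a (pair_coord s.1 i) (pair_coord s.1 u) = 0.
Proof.
move=> a2; rewrite /far_from => + ->.
case: s.2 => /= far.
  apply: dspline_at1 => //; rewrite /cell_start; lia.
by apply: dspline_at0 => //; apply: leq_trans far; rewrite ltnS.
Qed.

Lemma NsplineE i (u : R * R) : S u ->
  Nspline i u = dspline d k 0 i.1 u.1 * dspline d k 0 i.2 u.2.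
Proof. by move=> [u1 u2]; rewrite /Nspline !bsplineE. Qed.

Lemma smooth_tensor s i m a b : far_from s i -> (a + b + m <= 2)%N ->
  smooth [set u : R * R | pair_coord s.1 u = s.2%:R] m
    (fun u : R * R => dspline d k a i.1 u.1 * dspline d k b i.2 u.2).
Proof.
move=> far.
have cont a' b' (u : R * R) : (a' + b' <= 2)%N ->
    {for u, continuous (fun u : R * R => dspline d k a' i.1 u.1 * dspline d k b' i.2 u.2)}.
  move=> ab; apply: cvgM.
    apply: (cvg_comp _ _ (@cvg_fst _ _ (nbhs u.1) (nbhs u.2) _));
      apply: dspline_continuous => //; lia.
  apply: (cvg_comp _ _ (@cvg_snd _ _ (nbhs u.1) (nbhs u.2) _));
    apply: dspline_continuous => //; lia.
have zero a' b' (u : R * R) : (a' + b' <= 2)%N -> pair_coord s.1 u = s.2%:R ->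
    dspline d k a' i.1 u.1 * dspline d k b' i.2 u.2 = 0.
  move=> ab us; have h a0 (a02 : (a0 <= 2)%N) := @dspline_far a0 s i u a02 far us.
  case: (s.1) h => /= h; rewrite h ?mulr0 ?mul0r //; lia.
elim: m a b => [|m IH] a b abm; split => //; try by move=> u; auto.
- by move=> u _; apply: cont; lia.
- by move=> u; apply: zero; lia.
- by move=> u _; apply: cont; lia.
- by move=> u; apply: zero; lia.
exists (fun u : R * R => dspline d k a.+1 i.1 u.1 * dspline d k b i.2 u.2),
  (fun u : R * R => dspline d k a i.1 u.1 * dspline d k b.+1 i.2 u.2).
split; [by apply: IH; lia|by apply: IH; lia|move=> u _].
by apply: grad_tensor => x; apply: is_derive_dspline => //; lia.
Qed.

Definition patch_inv l (x : R * R) : R * R := xget (0, 0) [set u | S u /\ G l u = x].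

Lemma patch_invK l u : S u -> patch_inv l (G l u) = u.
Proof.
move=> Su; rewrite /patch_inv; case: xgetP => [v _ [Sv vu]|/(_ u)]; last by case.
exact: patch_map_inj hG _ _ _ Sv Su vu.
Qed.

Definition zero_trace (w : R * R -> R) l (x : R * R) : Prop :=
  w @ within (patch_set G l)° (nbhs x) --> (0 : R).

(** Three layers of zero coefficients make the spline vanish to second order along the side. *)
Lemma zero_traces w (b : 'I_P -> spline_index d k -> R) l s x : is_coefs G w b ->
  (forall i, b l i != 0 -> far_from s i) -> edge G l s x ->
  [/\ zero_trace w l x, forall a, zero_trace ('D_a w) l x
    & forall a a', zero_trace ('D_a ('D_a' w)) l x].
Proof.
move=> wb far [u [Su us] ux]; subst x.
have [p [tb [tc [te GE]]]] := patch_bilinear hG l.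
have J0 v : S v -> jac tb tc te v != 0.
  by move=> Sv; have := patch_regular hG l Sv; rewrite (derive_bilinear1 GE) (derive_bilinear2 GE).
pose Z := [set u : R * R | pair_coord s.1 u = s.2%:R].
pose F u := \sum_i b l i * (dspline d k 0 i.1 u.1 * dspline d k 0 i.2 u.2).
have sF : smooth Z 2 F.
  apply: smooth_sum => i; have [->|bi] := eqVneq (b l i) 0.
    rewrite (_ : (fun u => _) = cst 0); first exact: smooth0.
    by apply/funext => v; rewrite mul0r.
  rewrite (_ : (fun u => _) =
      (fun u => dspline d k 0 i.1 u.1 * dspline d k 0 i.2 u.2 * cst (b l i) u)).
    by apply: smoothM; [exact: smooth_tensor (far _ bi) _|exact: smooth_cst].
  by apply/funext => v; rewrite mulrC.
have HK := @patch_invK l.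
have wF y : (patch_set G l)° y -> w y = F (patch_inv l y).
  move=> /interior_subset [v Sv <-]; rewrite HK // (wb l v Sv); apply: eq_bigr => i _.
  by rewrite NsplineE.
have tr n F' g : smooth Z n F' -> (forall y, (patch_set G l)° y -> g y = F' (patch_inv l y)) ->
    zero_trace g l (G l u).
  by move=> sF' gF'; exact: (smooth_trace GE J0 HK sF' gF' us Su).
split=> [|a|a a']; first exact: tr sF wF.
  have [F' sF' dF'] := smooth_derive GE J0 HK a sF.
  by apply: tr sF' _; exact: dF'.
have [F' sF' dF'] := smooth_derive GE J0 HK a' sF.
have [F'' sF'' dF''] := smooth_derive GE J0 HK a sF'.
by apply: tr sF'' _; apply: dF''; exact: dF'.
Qed.

Definition patch_fun l (c : spline_index d k -> R) (x : R * R) : R :=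
  if `[< patch_set G l x >] then \sum_i c i * Nspline i (patch_inv l x) else 0.

(** On another patch the function is zero also at the points shared with patch l, because
these lie on sides with a neighbour. *)
Lemma patch_fun_coefs l c : (forall i, c i != 0 -> interior_index l i) ->
  is_coefs G (patch_fun l c) (fun l' i => if l' == l then c i else 0).
Proof.
move=> cin l' u Su; rewrite /patch_fun; have [->|l'l] := eqVneq l' l.
  by case: asboolP => [_|[]]; [rewrite patch_invK|exists u].
rewrite [RHS]big1 => [|i _]; last by rewrite mul0r.
case: asboolP => // -[v Sv vu].
rewrite -vu patch_invK //; apply: big1 => i _.
have [->|/cin/interior_indexP far] := eqVneq (c i) 0; first by rewrite mul0r.
have ll' : l != l' by rewrite eq_sym.
have lv : patch_set G l' (G l v) by rewrite vu; exists u.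
have [s sb us] := shared_point hG ll' Sv lv.
have := @dspline_far 0 s i v isT (far s sb) us.
by rewrite NsplineE //; case: (s.1) => /= ->; rewrite ?mul0r !mulr0.
Qed.

Lemma patch_fun_isogeometric l c : (forall i, c i != 0 -> interior_index l i) ->
  isogeometric G d k (patch_fun l c).
Proof.
move=> cin; have hb := patch_fun_coefs cin.
split.
- by move=> x hx; rewrite /patch_fun; case: asboolP => // lx; case: hx; exists l.
- by exists (fun l' i => if l' == l then c i else 0).
move=> l1 l2 s1 s2 l12 e x x1.
have x2 : edge G l2 s2 x by rewrite -e.
have far m s : ~ boundary_side G m s ->
    forall i, (if m == l then c i else 0) != 0 -> far_from s i.
  move=> sb i; have [ml|_] := eqVneq m l; last by rewrite eqxx.
  by subst m => /cin/interior_indexP; apply.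
have b1 : ~ boundary_side G l1 s1 by apply; exists l1, l2, s1, s2.
have b2 : ~ boundary_side G l2 s2 by apply; rewrite -e; exists l1, l2, s1, s2.
have [t1 d1 dd1] := zero_traces hb (far _ _ b1) x1.
have [t2 d2 dd2] := zero_traces hb (far _ _ b2) x2.
by split=> [|a _|a a' _ _]; exists 0; split => //; [exact: d1|exact: d2|exact: dd1|exact: dd2].
Qed.

(** The C^2 conditions across the edges hold automatically, because near an edge the layers of
zero coefficients make both sides vanish to second order; only the support of the
coefficients matters. *)
Lemma patch_spaceE l : patch_space G d k l =
  [set w | exists2 c, forall i, c i != 0 -> interior_index l i & w = patch_fun l c].
Proof.
apply/seteqP; split => w.
  move=> [[wout _ _] [b [wb bz]]]; exists (b l) => [i|].
    by apply: contra_neqT => /vanishing_index /bz.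
  apply/funext => x; rewrite /patch_fun; case: asboolP => [[u Su <-]|nx].
    by rewrite patch_invK // wb.
  have [[l' [u Su ux]]|nd] := pselect (mesh_domain G x); last exact: wout.
  rewrite -ux wb //; apply: big1 => i _; rewrite (bz (l', i)) ?mul0r //.
  by left; left => /= l'l; apply: nx; rewrite -l'l; exists u.
move=> [c cin ->]; split; first exact: patch_fun_isogeometric.
exists (fun l' i => if l' == l then c i else 0); split; first exact: patch_fun_coefs.
move=> [l' i] /=; have [->|//] := eqVneq l' l => /vanishing_index.
by move=> ni; apply/eqP; apply: contraNT ni; exact: cin.
Qed.

Lemma tensor_free (c : spline_index d k -> R) :
  (forall u, S u -> \sum_i c i * Nspline i u = 0) -> forall i, c i = 0.
Proof.
move=> c0 [i1 i2].
have free1 (f : 'I_(nb_splines d k) -> R) :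
    (forall x, 0 <= x <= 1 -> \sum_j f j * bspline (knots R d k) d j x = 0) -> forall j, f j = 0.
  move=> f0 i; rewrite -[i]inord_val.
  apply: (@bspline_free R d k d3 (fun j => f (inord j))) (ltn_ord i) => x x01.
  by rewrite -[RHS](f0 x x01); apply: eq_bigr => j _; rewrite inord_val.
apply: (free1 (fun j => c (i1, j)) _ i2) => y y01.
apply: (free1 (fun j => \sum_j2 c (j, j2) * bspline (knots R d k) d j2 y) _ i1) => x x01.
rewrite -[RHS](c0 (x, y)) //.
under eq_bigr do rewrite mulr_suml.
rewrite pair_bigA; apply: eq_bigr => -[j1 j2] _ /=.
by rewrite /Nspline /= -mulrA; congr (_ * _); rewrite mulrC.
Qed.

Lemma patch_space_dim l : has_dim (patch_space G d k l) #|[set i | interior_index l i]%SET|.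
Proof.
set A := [set i | interior_index l i]%SET.
pose v (j : 'I_#|A|) := patch_fun l (fun i => (i == enum_val j)%:R).
(* The coefficients c, indexed by an enumeration, read as a family over all indices. *)
pose ext (c : 'I_#|A| -> R) i := \sum_(j | enum_val j == i) c j.
have extE c j : ext c (enum_val j) = c j.
  rewrite /ext (big_pred1 j) // => j'; exact: (inj_eq enum_val_inj).
have ext_in c i : ext c i != 0 -> interior_index l i.
  apply: contra_neqT => ni; rewrite /ext big1 // => j /eqP ji.
  by move: (enum_valP j); rewrite ji inE (negbTE ni).
have vE c : \sum_j c j *: v j = patch_fun l (ext c).
  apply/funext => x; rewrite fct_sumE /v /patch_fun; case: asboolP => lx; last first.
    by apply: big1 => j _; rewrite /GRing.scale /= asboolF // scaler0.
  rewrite (eq_bigr (fun j => \sum_i c j * ((i == enum_val j)%:R * Nspline i (patch_inv l x)))).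
    rewrite exchange_big /=; apply: eq_bigr => i _; rewrite /ext mulr_suml [RHS]big_mkcond.
    apply: eq_bigr => j _; rewrite eq_sym; case: eqP => _; first by rewrite mul1r.
    by rewrite mul0r mulr0.
  by move=> j _; rewrite /GRing.scale /= asboolT // -[LHS]/(c j * _) mulr_sumr.
exists v; split.
  move=> c; rewrite vE => c0 j; rewrite -extE.
  apply: (tensor_free (c := ext c)) => u Su.
  have := congr1 (fun f => f (G l u)) c0; rewrite /patch_fun /=.
  by case: asboolP => [_|[]]; [rewrite patch_invK|exists u].
rewrite patch_spaceE; apply/seteqP; split => w.
  move=> [c cin ->]; exists (fun j => c (enum_val j)); rewrite vE; congr patch_fun.
  apply/funext => i; have [ii|ni] := boolP (i \in A).
    by rewrite -(enum_rankK_in ii ii) extE.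
  move: ni; rewrite inE => ni.
  rewrite (_ : c i = 0); last by apply/eqP; apply: contraNT ni; exact: cin.
  by apply/esym/eqP; apply: contraNT ni; exact: ext_in.
by move=> [c ->]; exists (ext c); [exact: ext_in|exact: vE].
Qed.

End PatchSpace.

(** * Counting free coefficients *)

Section Counting.
Variables (R : realType) (P : nat) (G : 'I_P -> R * R -> R * R) (d k : nat) (l : 'I_P).
Local Notation bd s := `[< boundary_side G l s >].

Lemma card_ord_between n lo hi : (hi <= n)%N ->
  #|[set j : 'I_n | (lo <= j < hi)%N]%SET| = (hi - lo)%N.
Proof.
move=> hn; rewrite -sum1dep_card big_mkcond /= -[X in (X - lo)%N](minn_idPr hn).
elim: n {hn} => [|n IH]; first by rewrite big_ord0 min0n.
by rewrite big_ord_recr /= IH; case: ifP => h; lia.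
Qed.

Lemma card_bool2 (f : pred (bool * bool)) :
  #|f| = (f (false, false) + f (false, true) + f (true, false) + f (true, true))%N.
Proof.
rewrite -sum1_card big_mkcond /= (eq_bigr (fun p => nat_of_bool (f (p.1, p.2)))); last first.
  by move=> [x y] _; rewrite unfold_in; case: (f _).
by rewrite -(pair_bigA _ (fun x y => nat_of_bool (f (x, y)))) /= !big_bool; do 4 case: (f _).
Qed.

Lemma nb_boundary_edgesE : nb_boundary_edges G l =
  (bd (false, false) + bd (false, true) + bd (true, false) + bd (true, true))%N.
Proof. exact: card_bool2. Qed.

Lemma nb_common_verticesE : nb_common_vertices G l =
  ((bd (false, false) + bd (false, true)) * (bd (true, false) + bd (true, true)))%N.
Proof.
have E (p : bool * bool) : `[< exists s s', [/\ s != s', boundary_side G l s, boundary_side G l s',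
    on_side s p & on_side s' p] >] = bd (false, p.1) && bd (true, p.2).
  apply/asboolP/andP => [[s [s' [ss bs bs' sp s'p]]]|[/asboolP b1 /asboolP b2]].
    by move: ss bs bs'; case: s s' sp s'p => [[] t] [[] t'] /eqP /= <- /eqP /= <-;
      rewrite ?eqxx // => _ b1 b2; split; apply/asboolP.
  by exists (false, p.1), (true, p.2); split => //; exact: eqxx.
rewrite /nb_common_vertices card_bool2 /= !E /=.
by do 4 case: asboolP => _.
Qed.

(** Each side with a neighbour removes three indices in its direction; d + k(d - 2) + 1 is large
enough for opposite layers to be disjoint. *)
Lemma card_interior : (5 <= d + k * (d - 2))%N -> #|[set i | @interior_index R P G d k l i]%SET| =
  ((d + k * (d - 2) + 1 - 3 * (2 - (bd (false, false) + bd (false, true))))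
  * (d + k * (d - 2) + 1 - 3 * (2 - (bd (true, false) + bd (true, true)))))%N.
Proof.
move=> n5.
pose ok b := [set j : 'I_(nb_splines d k) |
  (3 * ~~ bd (b, false) <= j < nb_splines d k - 3 * ~~ bd (b, true))%N]%SET.
have -> : [set i | @interior_index R P G d k l i]%SET = finset.setX (ok false) (ok true).
  apply/setP => -[i1 i2]; rewrite !inE /=.
  apply/forallP/andP => [h|[h1 h2] s].
    move: (ltn_ord i1) (ltn_ord i2).
    move: (h (false, false)) (h (false, true)) (h (true, false)) (h (true, true)).
    rewrite /far_from /=; move: (nat_of_ord i1) (nat_of_ord i2) => j1 j2.
    rewrite /nb_splines; move: (d + k * (d - 2))%N => n.
    by do 4 case: asboolP => _ /=; lia.
  move: (ltn_ord i1) (ltn_ord i2) h1 h2; rewrite /far_from.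
  case: s => [[] []] /=; move: (nat_of_ord i1) (nat_of_ord i2) => j1 j2;
  rewrite /nb_splines; move: (d + k * (d - 2))%N => n;
  by do 4 case: asboolP => _ /=; lia.
rewrite cardsX !card_ord_between ?leq_subr // /nb_splines.
by do 4 case: asboolP => _ /=; congr muln; lia.
Qed.

End Counting.

Local Close Scope ring_scope.
Local Close Scope classical_set_scope.

Theorem lemma2 (R : realType) (d k P : nat) (G : 'I_P -> R * R -> R * R)
    (hd : d = 5%N \/ d = 6%N) (hk : (7 - d <= k)%N)
    (hG : multipatch_domain G) (l : 'I_P) :
  let m := ((d - 2) * (k + 1))%N in
  let dimV := has_dim (patch_space G d k l) in
  match nb_boundary_edges G l, nb_common_vertices G l with
  | 0, _ => dimV ((m - 3) ^ 2)%N
  | 1, _ => dimV ((m - 3) * m)%N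
  | 2, 0 => dimV (m ^ 2 - 9)%N
  | 2, 1 => dimV (m ^ 2)%N
  | 3, _ => dimV ((m + 3) * m)%N
  | _, _ => False
  end.
Proof.
move=> m dimV.
have d3 : (3 <= d)%N by lia.
have nm : (d + k * (d - 2) + 1 = m + 3)%N by rewrite /m mulnDr muln1 mulnC; lia.
have m3 : (3 <= m)%N by rewrite /m; case: hd => ->; lia.
have := patch_space_dim (d := d) k hG d3 l; rewrite card_interior; last by lia.
rewrite nm -/dimV nb_boundary_edgesE nb_common_verticesE.
(* This excludes four boundary sides; the other impossible branches die by counting. *)
have [s /asboolPn] := exists_nonboundary_side hG l.
have sq n : (n ^ 2 = n * n)%N by rewrite expnS expn1.
have m9 : (m ^ 2 - 9 = (m - 3) * (m + 3))%N by rewrite -[9%N]/(3 ^ 2)%N subn_sqr.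
have a0 : (m + 3 - 3 * 2 = m - 3)%N by lia.
have a1 : (m + 3 - 3 * 1 = m)%N by lia.
have a2 : (m + 3 - 3 * 0 = m + 3)%N by lia.
case: s => [[] []];
case: `[< boundary_side G l (false, false) >]; case: `[< boundary_side G l (false, true) >];
case: `[< boundary_side G l (true, false) >]; case: `[< boundary_side G l (true, true) >] => //= _;
rewrite ?a0 ?a1 ?a2 ?sq ?m9 // mulnC //.
Qed.
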